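(* Let $G(\mathcal{I},\{J_i\}_i,\{\Omega_i\}_i)$ be an $N$-player game with, for every $i\in\mathcal I=\{1,\dots,N\}$, $\Omega_i\subset\mathbb{R}^{n_i}$ nonempty, convex and compact, and $J_i(x_i,x_{-i})$ of class $\mathcal C^1$ and convex in $x_i$ for every $x_{-i}\in\boldsymbol\Omega_{-i}$. Assume that: (a) the information exchange graph is undirected and connected; (b) the pseudo-gradient $F:\mathbb{R}^M\to\mathbb{R}^M$ is $\mu$-strongly monotone for some $\mu>0$; (c) $F$ is $\ell_F$-Lipschitz continuous and the extended pseudo-gradient $\boldsymbol F:\mathbb{R}^{NM}\to\mathbb{R}^M$ is $\ell_{\boldsymbol F}$-Lipschitz continuous, for some $\ell_F,\ell_{\boldsymbol F}>0$. Let $\gamma_1,\dots,\gamma_N>0$ and let $x^*\in\boldsymbol\Omega$ be the (unique) Nash equilibrium of the game. Then, for any initial condition in $$\boldsymbol\Xi=\{(\boldsymbol x,\boldsymbol k)\in\mathbb{R}^{NM}\times\mathbb{R}^N:\ \mathcal R\boldsymbol x\in\boldsymbol\Omega\},$$ there exists a unique Carath\'eodory solution $(\boldsymbol x(t),\boldsymbol k(t))$ to the closed-loop system $$\dot{\boldsymbol x}=\mathcal R^\top\,\Pi_{\boldsymbol\Omega}\big(\mathcal R\boldsymbol x,\,-\boldsymbol F(\boldsymbol x)-\mathcal R(LKL\otimes I_M)\boldsymbol x\big)-(I-\mathcal R^\top\mathcal R)(LKL\otimes I_M)\boldsymbol x,$$ $$\dot k_i=\gamma_i\|\boldsymbol\rho^i\|^2\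 (i=1,\dots,N),\qquad \boldsymbol\rho=-(L\otimes I_M)\boldsymbol x,\qquad K=\mathrm{diag}(k_1,\dots,k_N),$$ which belongs to $\boldsymbol\Xi$ for all $t\ge0$, and is such that $\lim_{t\to\infty}\boldsymbol x(t)=\mathbf 1_N\otimes x^*$.
   Context: Game: there are $N$ players; player $i$ chooses $x_i\in\Omega_i\subset\mathbb{R}^{n_i}$ to minimize its cost $J_i(x_i,x_{-i})$, where $x_{-i}$ collects the strategies of the other players. $M=\sum_{i=1}^N n_i$, $x=\mathrm{col}(x_1,\dots,x_N)\in\mathbb{R}^M$, $\boldsymbol\Omega=\Omega_1\times\dots\times\Omega_N$, $\boldsymbol\Omega_{-i}=\prod_{j\ne i}\Omega_j$, and $J_i:\mathbb{R}^M\to\mathbb{R}$. A vector $x^*\in\boldsymbol\Omega$ is a Nash equilibrium if $J_i(x_i^*,x_{-i}^* )\le\inf_{x_i\in\Omega_i}J_i(x_i,x_{-i}^* )$ for all $i$. Pseudo-gradient: $F(x)=\mathrm{col}\left(\frac{\partial J_1}{\partial x_1}(x_1,x_{-1}),\dots,\frac{\partial J_N}{\partial x_N}(x_N,x_{-N})\right)$. It is $\mu$-strongly monotone if $(x-y)^\top(F(x)-F(y))\ge\mu\|x-y\|^2$ for all $x,y$. Under the hypotheses, the Nash equilibrium exists and is unique. Each agent $i$ holds a local vector $\boldsymbol x^i=\mathrm{col}(x_1^i,\dots,x_N^i)\in\mathbb{R}^M$ with $x_j^i\in\mathbb{R}^{n_j}$, where $x_i^i=x_i$ is its own strategy and $x_j^i$,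 $j\ne i$, are its estimates of the others' strategies. Set $\boldsymbol x=\mathrm{col}(\boldsymbol x^1,\dots,\boldsymbol x^N)\in\mathbb{R}^{NM}$. Extended pseudo-gradient: $\boldsymbol F(\boldsymbol x)=\mathrm{col}\left(\frac{\partial J_1}{\partial x_1}(\boldsymbol x^1),\dots,\frac{\partial J_N}{\partial x_N}(\boldsymbol x^N)\right)\in\mathbb{R}^M$. $\mathcal R_i\in\mathbb{R}^{n_i\times M}$ is the matrix selecting the $i$-th block, $\mathcal R_i\boldsymbol x^i=x_i^i$, and $\mathcal R=\mathrm{diag}(\mathcal R_1,\dots,\mathcal R_N)$ (block diagonal), so $\mathcal R\boldsymbol x=\mathrm{col}(x_1^1,\dots,x_N^N)$. $I$ is the identity matrix of size $NM$. For a closed convex set $\Omega$, $x\in\Omega$ and a vector $v$, $\Pi_\Omega(x,v)$ is the Euclidean projection of $v$ onto the tangent cone of $\Omega$ at $x$. The information exchange graph is a graph on the $N$ agents with adjacency matrix entries $a_{i,j}\ge 0$ (symmetric if undirected) and Laplacian matrix $L$, so that $\boldsymbol\rho=\mathrm{col}(\boldsymbol\rho^1,\dots,\boldsymbol\rho^N)$ with $\boldsymbol\rho^i=\sum_{j=1}^N a_{i,j}(\boldsymbol x^j-\boldsymbol x^i)\in\mathbb{R}^M$. $\boldsymbol k=\mathrm{col}(k_1,\dots,k_N)\in\mathbb{R}^N$, $\otimes$ is the Kronecker product, $\mathbf 1_N$ is the all-ones vector in $\mathbb{R}^N$, $\|\cdot\|$ is the Euclidean norm. A Carath\'eodory solution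 is an absolutely continuous (on compact intervals) function on $[0,\infty)$ satisfying the differential equation for almost every $t\ge0$. *)

(* Defs.v *)
(* MathComp / MathComp-Analysis. *)
From HB Require Import structures.
From mathcomp Require Import all_boot all_order all_algebra.
From mathcomp Require Import all_classical all_reals all_analysis.

Set Implicit Arguments.
Unset Strict Implicit.
Unset Printing Implicit Defensive.

Import Order.TTheory GRing.Theory Num.Theory.
Import numFieldNormedType.Exports.

Local Open Scope classical_set_scope.
Local Open Scope ring_scope.

(* The library norm `|_| on matrices is the sup norm (it induces the same
   topology); every quantitative statement uses the Euclidean norm below. *)
Definition dotv (R : realType) m (u v : 'cV[R]_m) : R := (u^T *m v) 0 0.

Definition enorm (R : realType) m (u : 'cV[R]_m) : R := Num.sqrt (dotv u u).

Definition elipschitz (R : realType) p q (l : R)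
    (f : 'cV[R]_p -> 'cV[R]_q) : Prop :=
  forall x y, enorm (f x - f y) <= l * enorm (x - y).

Definition strongly_monotone (R : realType) m (mu : R)
    (f : 'cV[R]_m -> 'cV[R]_m) : Prop :=
  forall x y, mu * enorm (x - y) ^+ 2 <= dotv (x - y) (f x - f y).

Definition gradient (R : realType) m (f : 'cV[R]_m -> R)
    (x : 'cV[R]_m) : 'cV[R]_m :=
  \col_k 'D_(delta_mx k 0 : 'cV[R]_m) f x.

Definition class_C1 (R : realType) m (f : 'cV[R]_m -> R) : Prop :=
  (forall x, differentiable f x) /\ continuous (gradient f).

(* For convex S and x in S this is the usual tangent cone of S at x. *)
Definition tangent_cone (R : realType) m (S : set 'cV[R]_m)
    (x : 'cV[R]_m) : set 'cV[R]_m :=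
  closure [set v | exists2 d : R, 0 < d &
                   exists2 y, S y & v = d^-1 *: (y - x)].

(* A point of S nearest to v; it exists and is unique when S is nonempty,
   closed and convex. *)
Definition eproj (R : realType) m (S : set 'cV[R]_m)
    (v : 'cV[R]_m) : 'cV[R]_m :=
  xget 0 [set p | S p /\ forall q, S q -> enorm (v - p) <= enorm (v - q)].

Definition tproj (R : realType) m (S : set 'cV[R]_m)
    (x v : 'cV[R]_m) : 'cV[R]_m :=
  eproj (tangent_cone S x) v.

(* R^M, with M the sum of the n_i, is 'cV_(\sum_i n i): col(x_1, ..., x_N) is
   \mxcol_i x_i and its i-th block is submxcol x i.  Likewise R^(NM) is
   'cV_(\sum_(i < N) \sum_j n j), with N blocks of size M.  Sizes of Kronecker
   products are written in the same way, p blocks of size p' instead of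
   p * p', so that they can be multiplied with such block vectors. *)
Definition kron (R : realType) p q p' q' (A : 'M[R]_(p, q))
    (B : 'M[R]_(p', q')) :
    'M[R]_(\sum_(i < p) p', \sum_(j < q) q') :=
  \mxblock_(i < p, j < q) (A i j *: B).

Definition laplacian (R : realType) N (a : 'M[R]_N) : 'M[R]_N :=
  diag_mx (\row_i \sum_j a i j) - a.

(* Vertices i and j are adjacent when a i j > 0. *)
Definition undirected (R : realType) N (a : 'M[R]_N) : Prop :=
  (forall i j, 0 <= a i j) /\ (forall i j, a i j = a j i).

Definition graph_connected (R : realType) N (a : 'M[R]_N) : Prop :=
  forall i j, connect (fun u v => 0 < a u v) i j.

Section Game.
Context (R : realType) (N : nat) (n : 'I_N -> nat).
Local Notation M := (\sum_(i < N) n i)%N.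
Local Notation NM := (\sum_(i < N) M)%N.

Definition strategies (Omega : forall i, set 'cV[R]_(n i)) : set 'cV[R]_M :=
  [set x | forall i, Omega i (submxcol x i)].

(* The profile (y, x_{-i}). *)
Definition deviate (x : 'cV[R]_M) (i : 'I_N) (y : 'cV[R]_(n i)) : 'cV[R]_M :=
  \mxcol_j (dfwith (fun j => submxcol x j) i y j).

Definition cost_convex (Omega : forall i, set 'cV[R]_(n i))
    (J : 'I_N -> 'cV[R]_M -> R) (i : 'I_N) : Prop :=
  forall x : 'cV[R]_M, (forall j, j != i -> Omega j (submxcol x j)) ->
  convex_function (E := 'cV[R]_(n i)) setT (fun y => J i (deviate x y)).

Definition Nash_equilibrium (Omega : forall i, set 'cV[R]_(n i))
    (J : 'I_N -> 'cV[R]_M -> R) (x : 'cV[R]_M) : Prop :=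
  strategies Omega x /\
  forall i, ((J i x)%:E <=
             ereal_inf [set (J i (deviate x y))%:E | y in Omega i])%E.

Definition pseudo_gradient (J : 'I_N -> 'cV[R]_M -> R)
    (x : 'cV[R]_M) : 'cV[R]_M :=
  \mxcol_i submxcol (gradient (J i) x) i.

Definition ext_pseudo_gradient (J : 'I_N -> 'cV[R]_M -> R)
    (x : 'cV[R]_NM) : 'cV[R]_M :=
  \mxcol_i submxcol (gradient (J i) (submxcol x i)) i.

(* The rows of the identity matrix of size M in the i-th block. *)
Definition selblock (i : 'I_N) : 'M[R]_(n i, M) := submxcol 1%:M i.

Definition selmx : 'M[R]_(M, NM) :=
  \mxblock_(i < N, j < N) (if i == j then selblock i else 0).

Definition Xi (Omega : forall i, set 'cV[R]_(n i)) :
    set ('cV[R]_NM * 'cV[R]_N) :=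
  [set xk | strategies Omega (selmx *m xk.1)].

Definition LKL (a : 'M[R]_N) (k : 'cV[R]_N) : 'M[R]_N :=
  laplacian a *m diag_mx k^T *m laplacian a.

Definition rho (a : 'M[R]_N) (x : 'cV[R]_NM) : 'cV[R]_NM :=
  - (kron (laplacian a) (1%:M : 'M[R]_M) *m x).

Definition xdot (Omega : forall i, set 'cV[R]_(n i))
    (J : 'I_N -> 'cV[R]_M -> R) (a : 'M[R]_N)
    (x : 'cV[R]_NM) (k : 'cV[R]_N) : 'cV[R]_NM :=
  let W := kron (LKL a k) (1%:M : 'M[R]_M) in
  selmx^T *m tproj (strategies Omega) (selmx *m x)
               (- ext_pseudo_gradient J x - selmx *m W *m x)
  - (1%:M - selmx^T *m selmx) *m W *m x.

Definition kdot (a : 'M[R]_N) (gamma : 'I_N -> R) (x : 'cV[R]_NM) :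
    'cV[R]_N :=
  \col_i (gamma i * enorm (submxcol (rho a x) i) ^+ 2).

End Game.

Definition abs_continuous (R : realType) m (a b : R)
    (f : R -> 'cV[R]_m) : Prop :=
  forall e : R, 0 < e -> exists2 d : R, 0 < d &
  forall (p : nat) (u v : 'I_p -> R),
    (forall i, a <= u i /\ u i <= v i /\ v i <= b) ->
    trivIset setT (fun i => [set` `]u i, v i[]) ->
    \sum_i (v i - u i) < d ->
    \sum_i enorm (f (v i) - f (u i)) < e.

(* Functions are total on R; only their values on [0, +oo[ matter. *)
Definition Caratheodory_solution (R : realType) N (n : 'I_N -> nat)
    (Omega : forall i, set 'cV[R]_(n i))
    (J : 'I_N -> 'cV[R]_(\sum_(i < N) n i) -> R)
    (a : 'M[R]_N) (gamma : 'I_N -> R)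
    (x : R -> 'cV[R]_(\sum_(i < N) \sum_(j < N) n j))
    (k : R -> 'cV[R]_N) : Prop :=
  (forall T1 T2 : R, 0 <= T1 -> T1 <= T2 ->
     abs_continuous T1 T2 x /\ abs_continuous T1 T2 k) /\
  {ae @lebesgue_measure R, forall t : R, 0 <= t ->
     is_derive t (1 : R) x (xdot Omega J a (x t) (k t)) /\
     is_derive t (1 : R) k (kdot a gamma (x t))}.

(* Main.v *)
Require Import Defs.
From HB Require Import structures.
From mathcomp Require Import all_boot all_order all_algebra.
From mathcomp Require Import all_classical all_reals all_analysis.
From mathcomp Require Import ring lra.

(** Dividing each gain k_i by sqrt gamma_i turns the closed loop into projected
    dynamics: with z = (x, k_i / sqrt gamma_i), the velocity is the Euclidean
    projection of a locally Lipschitz field f z on the tangent cone at z of the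
    closed convex set C of the z with R x in Omega.  By Moreau's decomposition
    the velocity w is characterized by the variational inequality
    <f z - w, y - z> <= 0 for y in C, together with w being tangent and
    orthogonal to f z - w ([closed_loop_vi], [xdot_of_vi]).

    Dissipation.  Let zbar = (1 (x) x*, kstar / sqrt gamma_i).  The terms
    k_i |rho^i|^2 coming from the gains and from the quadratic form of LKL
    cancel, so that <f z, z - zbar> = - <F(x), R x - x*> - kstar |rho|^2
    whatever the gains are ([field_dissipation]).  Split x into its consensus
    part 1 (x) xi, with xi the average of the x^i, and the disagreement.
    Strong monotonicity at xi and x* and the variational inequality of the Nash
    equilibrium ([Nash_variational]) control the first, and connectedness bounds
    the second by a multiple of |rho| ([consensus_error_bound]).  Hence for
    kstar large enough <f z, z - zbar> <= - c |x - 1 (x) x*|^2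
    ([gain_dominates]): the distance to zbar does not increase, and everything
    takes place in a ball B around zbar, on which f is Lipschitz.

    Existence.  The projected Euler scheme z' = P(z + h f z), with P the
    projection on the compact convex set C /\ B, satisfies
      |z t - y|^2 <= |z s - y|^2 + 2 (t - s) <f (z s), z s - y> + K (t - s)^2
    for y in C /\ B up to terms that vanish with h.  By compactness the iterates
    have limits along an ultrafilter of steps h, at all times at once, and the
    inequality passes to the limit ([evi_existence]).  It contains everything:
    y = z s gives the Lipschitz continuity of z, hence its derivative almost
    everywhere ([lipschitz_ae_derivable]); at such a time it becomes the
    variational inequality for the velocity; y = zbar shows that z stays in the
    interior of B, and that |z - zbar|^2 would decrease by a fixed amount during
    a fixed time as often as c |x - 1 (x) x*|^2 exceeds a given e, so that x
    tends to 1 (x) x* ([projected_dynamics_solution]).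

    Uniqueness.  A Caratheodory solution stays in C, because its squared
    distance to C cannot increase ([ae_viable]), and in B, by dissipation
    ([ae_dissipative_sqdist]).  Two solutions then agree by Gronwall's argument,
    the projection being monotone ([projected_dynamics_unique]).  All three
    rest on [ac_nonincreasing]: an absolutely continuous function whose upper
    right Dini derivative is nonpositive almost everywhere is nonincreasing. *)

Set Implicit Arguments.
Unset Strict Implicit.
Unset Printing Implicit Defensive.

Import Order.TTheory GRing.Theory Num.Theory.
Import numFieldNormedType.Exports.

Local Open Scope classical_set_scope.
Local Open Scope ring_scope.

(** * Euclidean geometry of column vectors *)

Section euclid.
Context {R : realType} {m : nat}.
Implicit Types (u v w : 'cV[R]_m) (c : R).

Lemma dotvE u v : dotv u v = \sum_i u i 0 * v i 0.
Proof. by rewrite /dotv mxE; apply: eq_bigr => i _; rewrite mxE. Qed.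

Lemma dotvC u v : dotv u v = dotv v u.
Proof. by rewrite !dotvE; apply: eq_bigr => i _; rewrite mulrC. Qed.

Lemma dotvDl u v w : dotv (u + v) w = dotv u w + dotv v w.
Proof. by rewrite /dotv linearD mulmxDl mxE. Qed.

Lemma dotvDr u v w : dotv w (u + v) = dotv w u + dotv w v.
Proof. by rewrite /dotv mulmxDr mxE. Qed.

Lemma dotvNl u v : dotv (- u) v = - dotv u v.
Proof. by rewrite /dotv linearN mulNmx mxE. Qed.

Lemma dotvNr u v : dotv u (- v) = - dotv u v.
Proof. by rewrite /dotv mulmxN mxE. Qed.

Lemma dotvZl c u v : dotv (c *: u) v = c * dotv u v.
Proof. by rewrite /dotv linearZ -scalemxAl mxE. Qed.

Lemma dotvZr c u v : dotv u (c *: v) = c * dotv u v.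
Proof. by rewrite /dotv -scalemxAr mxE. Qed.

Lemma dotv0l u : dotv 0 u = 0.
Proof. by rewrite /dotv trmx0 mul0mx mxE. Qed.

Lemma dotv0r u : dotv u 0 = 0.
Proof. by rewrite dotvC dotv0l. Qed.

Definition dotv_lin := (dotvDl, dotvDr, dotvNl, dotvNr, dotvZl, dotvZr).

Lemma dotv_sqrD u v :
  dotv (u + v) (u + v) = dotv u u + 2 * dotv u v + dotv v v.
Proof. by rewrite dotvDl !dotvDr (dotvC v u); ring. Qed.

Lemma dotv_sqrB u v :
  dotv (u - v) (u - v) = dotv u u - 2 * dotv u v + dotv v v.
Proof. by rewrite dotv_sqrD !dotvNr dotvNl; ring. Qed.

Lemma dotv_subr_sqr u v : dotv u u - dotv v v = dotv (u - v) (u + v).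
Proof. by rewrite dotvDl dotvNl !dotvDr (dotvC v u); ring. Qed.

Lemma dotv_telescope (f0 f1 f2 u v w : 'cV[R]_m) :
  dotv f0 (u - w) = dotv (f0 - f1) (u - w) + dotv (f1 - f2) (u - v) +
    dotv (f1 - f2) (v - w) + dotv f2 (u - w).
Proof. by rewrite !(dotvDl, dotvDr, dotvNl, dotvNr); ring. Qed.

Lemma dotv_ge0 u : 0 <= dotv u u.
Proof. by rewrite dotvE sumr_ge0// => i _; rewrite -expr2 sqr_ge0. Qed.

Lemma dotv_eq0 u : dotv u u = 0 -> u = 0.
Proof.
rewrite dotvE => /eqP; rewrite psumr_eq0; last first.
  by move=> i _; rewrite -expr2 sqr_ge0.
move=> /allP u0; apply/matrixP => i j; rewrite ord1 mxE.
by have := u0 i (mem_index_enum _); rewrite /= mulf_eq0 orbb => /eqP.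
Qed.

Lemma enorm_ge0 u : 0 <= enorm u.
Proof. exact: sqrtr_ge0. Qed.

Lemma enorm_sqr u : enorm u ^+ 2 = dotv u u.
Proof. by rewrite /enorm sqr_sqrtr// dotv_ge0. Qed.

Lemma enorm0 : enorm (0 : 'cV[R]_m) = 0.
Proof. by rewrite /enorm dotv0l sqrtr0. Qed.

Lemma enorm_eq0 u : enorm u = 0 -> u = 0.
Proof. by move=> u0; apply: dotv_eq0; rewrite -enorm_sqr u0 expr0n. Qed.

Lemma enormN u : enorm (- u) = enorm u.
Proof. by rewrite /enorm !dotv_lin opprK. Qed.

Lemma enormB u v : enorm (u - v) = enorm (v - u).
Proof. by rewrite -enormN opprB. Qed.

Lemma enormZ c u : enorm (c *: u) = `|c| * enorm u.
Proof.
by rewrite /enorm !dotv_lin mulrA -expr2 sqrtrM ?sqr_ge0// sqrtr_sqr.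
Qed.

(** Cauchy-Schwarz: expand the square of |v| u - |u| v. *)
Lemma dotv_le_enorm u v : dotv u v <= enorm u * enorm v.
Proof.
set b := enorm v; have [b0|b0] := eqVneq b 0.
  by rewrite (enorm_eq0 b0) dotv0r b0 mulr0.
have bp : 0 < b by rewrite lt_def b0 enorm_ge0.
set a := enorm u; have := dotv_ge0 (b *: u - a *: v).
rewrite !dotv_lin (dotvC v u) -!enorm_sqr -/a -/b.
have [a0|a0] := eqVneq a 0.
  by move=> _; rewrite (enorm_eq0 a0) dotv0l a0 mul0r.
have ap : 0 < a by rewrite lt_def a0 enorm_ge0.
move=> h; have : 0 <= (2 * (a * b)) * (a * b - dotv u v).
  by apply: le_trans h _; rewrite le_eqVlt; apply/orP; left; apply/eqP; ring.
rewrite pmulr_rge0 ?subr_ge0//.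
by rewrite mulr_gt0// mulr_gt0.
Qed.

Lemma dotv_abs_le u v : `|dotv u v| <= enorm u * enorm v.
Proof.
rewrite ler_norml dotv_le_enorm andbT lerNl -dotvNl.
by rewrite (le_trans (dotv_le_enorm _ _))// enormN.
Qed.

Lemma enormD u v : enorm (u + v) <= enorm u + enorm v.
Proof.
rewrite -(ler_pXn2r (n := 2)) ?nnegrE ?addr_ge0 ?enorm_ge0//.
rewrite sqrrD !enorm_sqr !dotv_lin (dotvC v u).
have := dotv_le_enorm u v; lra.
Qed.

Lemma enorm_dist u v w : enorm (u - w) <= enorm (u - v) + enorm (v - w).
Proof. by rewrite -[u - w](subrKA v) enormD. Qed.

Lemma enorm_le_sqr u c : 0 <= c -> dotv u u <= c ^+ 2 -> enorm u <= c.
Proof. by move=> c0; rewrite -enorm_sqr ler_pXn2r ?nnegrE ?enorm_ge0. Qed.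

Lemma coord_le_enorm u i : `|u i 0| <= enorm u.
Proof.
rewrite /enorm -sqrtr_sqr ler_wsqrtr// dotvE (bigD1 i)//= expr2 lerDl.
by rewrite sumr_ge0// => j _; rewrite -expr2 sqr_ge0.
Qed.

Lemma enorm_le_sum u : enorm u <= \sum_i `|u i 0|.
Proof.
have : enorm u ^+ 2 <= (\sum_i `|u i 0|) * enorm u.
  rewrite enorm_sqr dotvE mulr_suml; apply: ler_sum => i _.
  apply: (le_trans (ler_norm _)); rewrite normrM.
  by apply: ler_pM => //; exact: coord_le_enorm.
rewrite expr2; have [->|u0] := eqVneq (enorm u) 0.
  by move=> _; exact: sumr_ge0.
by rewrite ler_pM2r// lt_def u0 enorm_ge0.
Qed.

Lemma mxnorm_le_enorm u : `|u| <= enorm u.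
Proof.
rewrite /Num.norm/= mx_normrE; apply/bigmax_leP; split; first exact: enorm_ge0.
by move=> -[i j] _ /=; rewrite ord1 coord_le_enorm.
Qed.

Lemma enorm_le_mxnorm u : enorm u <= m.+1%:R * `|u|.
Proof.
apply: enorm_le_sqr; first by rewrite mulr_ge0.
have uij i : u i 0 * u i 0 <= `|u| ^+ 2.
  rewrite -expr2 -real_normK ?num_real// ler_pXn2r ?nnegrE//.
  rewrite [leRHS]/Num.norm/= mx_normrE.
  by apply/bigmax_geP; right; exists (i, 0).
rewrite dotvE (le_trans (ler_sum _ (fun i _ => uij i)))//.
rewrite sumr_const card_ord -[leLHS]mulr_natl exprMn ler_wpM2r ?sqr_ge0//.
by rewrite -natrX ler_nat (leq_trans (leqnSn m))// leq_pmulr.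
Qed.

Lemma cvg_enorm {T : Type} (F : set_system T) {FF : Filter F}
    (f : T -> 'cV[R]_m) (l : 'cV[R]_m) :
  f x @[x --> F] --> l <->
  (forall e : R, 0 < e -> \forall x \near F, enorm (f x - l) < e).
Proof.
split=> [/cvgrPdist_lt h e e0|h].
  have e0' : 0 < e / m.+1%:R by rewrite divr_gt0.
  apply: filterS (h _ e0') => x; rewrite ltr_pdivlMr// mulrC -normrN opprB.
  by apply: le_lt_trans; exact: enorm_le_mxnorm.
apply/cvgrPdist_lt => e /h; apply: filterS => x.
by apply: le_lt_trans; rewrite -normrN opprB mxnorm_le_enorm.
Qed.

Lemma nbhs_enormP u (A : set 'cV[R]_m) :
  nbhs u A <-> exists2 e, 0 < e & (forall v, enorm (v - u) < e -> A v).
Proof.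
split.
  move=> /nbhs_ballP[e /= e0 eA]; exists e => // v ve; apply: eA.
  by rewrite -ball_normE /= (le_lt_trans _ ve)// -normrN opprB mxnorm_le_enorm.
move=> [e e0 eA]; apply/nbhs_ballP; exists (e / m.+1%:R) => /=.
  by rewrite divr_gt0.
move=> v; rewrite -ball_normE /= ltr_pdivlMr// mulrC -normrN opprB => h;
  apply: eA.
exact: le_lt_trans (enorm_le_mxnorm _) h.
Qed.

Lemma closure_enorm (A : set 'cV[R]_m) u :
  closure A u <-> forall e, 0 < e -> exists2 v, A v & enorm (v - u) < e.
Proof.
split=> [cA e e0|h B /nbhs_enormP[e e0 eB]].
  have [] := cA [set v | enorm (v - u) < e].
    by apply/nbhs_enormP; exists e.
  by move=> v [Av ve]; exists v.
by have [v Av ve] := h e e0; exists v; split => //; exact: eB.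
Qed.

Lemma closed_enorm (A : set 'cV[R]_m) : closed A <->
  forall u, (forall e, 0 < e -> exists2 v, A v & enorm (v - u) < e) -> A u.
Proof.
split=> [cA u h|h u /closure_enorm]; last exact: h.
by apply: cA; apply/closure_enorm.
Qed.

(** Heine-Borel, through the homeomorphism with row vectors given by
    transposition. *)
Lemma enorm_bounded_closed_compact (A : set 'cV[R]_m) r :
  closed A -> (forall u, A u -> enorm u <= r) -> compact A.
Proof.
move=> cA rA.
have -> : A = (@trmx R 1 m) @` [set v : 'rV[R]_m | A v^T].
  apply/seteqP; split => [u Au|_ [v Av <-]//].
  by exists u^T; rewrite /= trmxK.
have ctr p q : continuous (@trmx R p q).
  move=> M B /nbhs_ballP[e /= e0 eB]; apply/nbhs_ballP; exists e => //= M'.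
  move=> [h MM']; apply: eB; split=> // i j; rewrite !mxE; exact: MM'.
apply: continuous_compact; first exact/continuous_subspaceT/ctr.
apply: bounded_closed_compact.
  exists r; split; first exact: num_real.
  move=> x rx v /= /rA vr; apply: le_trans _ (ltW rx).
  apply: le_trans _ vr; apply: le_trans _ (mxnorm_le_enorm _).
  have -> : `|v| = `|v^T^T| by rewrite trmxK.
  rewrite /Num.norm/= mx_normrE; apply/bigmax_leP; split.
    exact: (normr_ge0 v^T).
  move=> -[i j] _ /=; rewrite mxE [leRHS]mx_normrE.
  by apply/bigmax_geP; right; exists (j, i).
by apply: (@closed_comp _ _ (@trmx R 1 m) A) => // v _; exact: ctr.
Qed.

End euclid.

Lemma le_enorm_sqr (R : realType) m p (u : 'cV[R]_m) (v : 'cV[R]_p) :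
  (enorm u <= enorm v) = (dotv u u <= dotv v v).
Proof. by rewrite -!enorm_sqr ler_pXn2r ?nnegrE ?enorm_ge0. Qed.

(** * Projections and tangent cones *)

Section projection.
Context {R : realType} {m : nat}.
Implicit Types (S T : set 'cV[R]_m) (u v w x y p q : 'cV[R]_m).

Definition segment_closed S := forall x y (t : R), 0 <= t -> t <= 1 ->
  S x -> S y -> S (x + t *: (y - x)).

Lemma convex_segment_closed S : convex_set S -> segment_closed S.
Proof.
move=> cS x y t t0 t1 Sx Sy.
have := cS y x (Itv01 t0 t1) (mem_set Sy) (mem_set Sx).
rewrite inE; congr (S _).
rewrite /conv/= /unstable.onem.
by apply/matrixP => i j; rewrite !mxE; ring.
Qed.

(** The distance to v attains its minimum on the compact part of S lying within
    the distance from v to some point of S. *)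
Lemma eprojP S v : S !=set0 -> closed S ->
  S (eproj S v) /\ forall q, S q -> enorm (v - eproj S v) <= enorm (v - q).
Proof.
move=> [y0 Sy0] cS; rewrite /eproj; case: xgetP => [p _ []//|none].
exfalso.
pose K := S `&` [set u | enorm (v - u) <= enorm (v - y0)].
have cnorm u w : `|enorm (v - u) - enorm (v - w)| <= enorm (u - w).
  rewrite ler_norml; apply/andP; split.
    have := enorm_dist v u w; lra.
  by have := enorm_dist v w u; rewrite (enormB w u); lra.
have cK : compact K.
  apply: (@enorm_bounded_closed_compact _ _ _ (enorm v + enorm (v - y0))).
    apply: closedI => //; apply/closed_enorm => u h /=.
    apply/ler_addgt0Pr => e e0; have [w /= wy we] := h e e0.
    by have := enorm_dist v w u; lra.
  move=> u [_ /= uy]; have := enorm_dist u v 0; move: uy.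
  by rewrite !subr0 (enormB u v); lra.
have K0 : K !=set0 by exists y0; split => /=.
have cont : {within K, continuous (fun u => enorm (v - u))}.
  apply: continuous_subspaceT => u B /nbhs_ballP[e /= e0 eB].
  apply/nbhs_enormP; exists e => // w we; apply: eB; rewrite -ball_normE /=.
  by rewrite (le_lt_trans (cnorm _ _))// enormB.
have [p] := compact_EVT_min K0 cK cont; rewrite inE => -[Sp py] pmin.
apply: (none p); split=> // q Sq.
have [qy|/ltW qy] := leP (enorm (v - q)) (enorm (v - y0)).
  by apply: pmin; rewrite inE.
exact: le_trans py qy.
Qed.

(** Moving from p towards q by t changes the squared distance to v by
    t (t D - 2 a), where a is the inner product in question and D = |q - p|^2;
    a > 0 would make this negative for small t. *)
Lemma nearest_vi S v p : segment_closed S -> S p ->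
  (forall q, S q -> enorm (v - p) <= enorm (v - q)) ->
  forall q, S q -> dotv (v - p) (q - p) <= 0.
Proof.
move=> cS Sp pmin q Sq.
set D := dotv (q - p) (q - p); have D0 : 0 <= D := dotv_ge0 _.
rewrite leNgt; apply/negP => a0; set a := dotv _ _ in a0.
have step t : 0 <= t -> t <= 1 -> 0 <= t * (t * D - 2 * a).
  move=> t0 t1; have := pmin _ (cS p q t t0 t1 Sp Sq).
  rewrite le_enorm_sqr opprD addrA.
  rewrite [leRHS]dotv_sqrB dotvZl !dotvZr -/a -/D -addrA lerDl => h.
  by apply: le_trans h _; rewrite le_eqVlt; apply/orP; left; apply/eqP; ring.
(* The step t = a / (D + a) is at most 1 and gives t D <= a < 2 a. *)
have s0 : 0 < a / (D + a) by rewrite divr_gt0// ltr_wpDl.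
have s1 : a / (D + a) <= 1 by rewrite ler_pdivrMr ?mul1r ?lerDr ?ltr_wpDl.
have := step _ (ltW s0) s1; rewrite pmulr_rge0// => h.
have : a / (D + a) * D <= a.
  by rewrite mulrAC ler_pdivrMr ?ltr_wpDl// ler_pM2l// lerDl ltW.
by move=> h'; lra.
Qed.

Lemma eproj_vi S v : S !=set0 -> closed S -> segment_closed S ->
  forall q, S q -> dotv (v - eproj S v) (q - eproj S v) <= 0.
Proof.
by move=> S0 cS sS; have [Sp pmin] := eprojP v S0 cS; exact: nearest_vi.
Qed.

Lemma eproj_unique S v p : S p ->
  (forall q, S q -> dotv (v - p) (q - p) <= 0) -> eproj S v = p.
Proof.
move=> Sp pvi.
have near q : S q -> dotv (v - p) (v - p) + dotv (q - p) (q - p)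
                       <= dotv (v - q) (v - q).
  move=> Sq; have h := pvi q Sq.
  by rewrite -[v - q](subrKA p) -[p - q]opprB [leRHS]dotv_sqrB; lra.
have Pp : S p /\ forall q, S q -> enorm (v - p) <= enorm (v - q).
  split=> // q Sq; rewrite le_enorm_sqr (le_trans _ (near q Sq))//.
  by rewrite lerDl dotv_ge0.
rewrite /eproj; case: xgetP => [q _ [Sq qmin]|/(_ p)//].
have := qmin p Sp; rewrite le_enorm_sqr => /(le_trans (near q Sq)).
rewrite gerDl => h; apply/eqP; rewrite -subr_eq0; apply/eqP/dotv_eq0/eqP.
by rewrite eq_le h dotv_ge0.
Qed.

(** Fejer property: projecting brings v closer to each point of S. *)
Lemma eproj_nonexp_to S v y : S !=set0 -> closed S -> segment_closed S -> S y ->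
  enorm (eproj S v - y) <= enorm (v - y).
Proof.
move=> S0 cS sS Sy; have := eproj_vi v S0 cS sS Sy; set p := eproj S v => h.
rewrite le_enorm_sqr -[v - y](subrKA p) [leRHS]dotv_sqrD.
move: h; rewrite -(opprB p y) dotvNr oppr_le0 => h.
have := dotv_ge0 (v - p); lra.
Qed.

Lemma closed_tangent_cone S x : closed (tangent_cone S x).
Proof. exact: closed_closure. Qed.

Lemma tangent_cone_dir S x y (c : R) : 0 < c -> S y ->
  tangent_cone S x (c *: (y - x)).
Proof.
move=> c0 Sy; apply: subset_closure; exists c^-1; rewrite ?invr_gt0//.
by exists y => //; rewrite invrK.
Qed.

Lemma tangent_cone_scale S x w (c : R) : 0 < c ->
  tangent_cone S x w -> tangent_cone S x (c *: w).
Proof.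
move=> c0 /closure_enorm h; apply/closure_enorm => e e0.
have [_ [d d0 [y Sy ->]] we] := h (e / c) (divr_gt0 e0 c0).
exists ((d / c)^-1 *: (y - x)).
  by exists (d / c); [rewrite divr_gt0|exists y].
rewrite invf_div -scalerA -scalerBr enormZ gtr0_norm//.
by rewrite mulrC -ltr_pdivlMr.
Qed.

Lemma tangent_cone0 S x : S !=set0 -> tangent_cone S x 0.
Proof.
move=> [y Sy]; apply/closure_enorm => e e0.
pose c := e / (enorm (y - x) + 1).
have p0 : 0 < enorm (y - x) + 1 by rewrite ltr_wpDl ?enorm_ge0.
have c0 : 0 < c by rewrite divr_gt0.
exists (c *: (y - x)); first by exists c^-1; rewrite ?invr_gt0//; exists y;
  rewrite ?invrK.
rewrite subr0 enormZ gtr0_norm// /c mulrAC ltr_pdivrMr// ltr_pM2l//.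
by rewrite ltrDl.
Qed.

(** A convex combination of directions (y1 - x) / d1 and (y2 - x) / d2 is the
    direction of the point of [y1, y2] with weights proportional to
    (1 - t) / d1 and t / d2. *)
Lemma tangent_cone_segment_closed S x :
  segment_closed S -> segment_closed (tangent_cone S x).
Proof.
move=> sS w1 w2 t t0 t1 /closure_enorm h1 /closure_enorm h2.
apply/closure_enorm => e e0.
have [_ [d1 d10 [y1 Sy1 ->]] we1] := h1 e e0.
have [_ [d2 d20 [y2 Sy2 ->]] we2] := h2 e e0.
pose c1 := (1 - t) / d1; pose c2 := t / d2.
have c10 : 0 <= c1 by rewrite divr_ge0 ?subr_ge0// ltW.
have c20 : 0 <= c2 by rewrite divr_ge0// ltW.
have cp : 0 < c1 + c2.
  have [t_1|tn1] := eqVneq t 1.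
    by rewrite ltr_wpDl// /c2 t_1 divr_gt0.
  by rewrite ltr_wpDr// divr_gt0// subr_gt0 lt_neqAle tn1.
exists ((1 - t) *: (d1^-1 *: (y1 - x)) + t *: (d2^-1 *: (y2 - x))).
  exists (c1 + c2)^-1; first by rewrite invr_gt0.
  exists (y1 + (c2 / (c1 + c2)) *: (y2 - y1)).
    apply: sS => //; first by rewrite divr_ge0// ltW.
    by rewrite ler_pdivrMr// mul1r lerDr.
  rewrite invrK !scalerA -/c1 -/c2.
  by apply/matrixP => i j; rewrite !mxE; field; exact: lt0r_neq0.
have -> : (1 - t) *: (d1^-1 *: (y1 - x)) + t *: (d2^-1 *: (y2 - x))
    - (w1 + t *: (w2 - w1)) =
    (1 - t) *: (d1^-1 *: (y1 - x) - w1) + t *: (d2^-1 *: (y2 - x) - w2).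
  by apply/matrixP => i j; rewrite !mxE; ring.
apply: (le_lt_trans (enormD _ _)); rewrite !enormZ !ger0_norm ?subr_ge0//.
have [t_0|tn0] := eqVneq t 0.
  by rewrite t_0 subr0 mul1r mul0r addr0.
have tp : 0 < t by rewrite lt_neqAle eq_sym tn0.
have : (1 - t) * enorm (d1^-1 *: (y1 - x) - w1) <= (1 - t) * e.
  by rewrite ler_wpM2l ?subr_ge0// ltW.
have : t * enorm (d2^-1 *: (y2 - x) - w2) < t * e by rewrite ltr_pM2l.
lra.
Qed.

Lemma tproj_tangent S x v : S !=set0 ->
  tangent_cone S x (tproj S x v).
Proof.
move=> S0; have Tne : tangent_cone S x !=set0.
  by exists 0; exact: tangent_cone0.
by have [] := eprojP v Tne (@closed_tangent_cone S x).
Qed.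

(** Moreau's decomposition: test the variational inequality of the projection
    with 0 and with twice the projected vector, both in the cone. *)
Lemma tproj_orth S x v : S !=set0 -> segment_closed S ->
  dotv (v - tproj S x v) (tproj S x v) = 0.
Proof.
move=> S0 sS; have T0 := tangent_cone0 x S0.
have Tne : tangent_cone S x !=set0 by exists 0.
have vi := eproj_vi v Tne (@closed_tangent_cone S x)
  (tangent_cone_segment_closed (x := x) sS).
have Tp : tangent_cone S x (tproj S x v) by exact: tproj_tangent.
rewrite -/(tproj S x v) in vi.
have := vi _ T0; rewrite sub0r dotvNr oppr_le0 => h1.
have := vi _ (tangent_cone_scale (ltr0Sn R 1) Tp).
rewrite dotvDr dotvNr dotvZr => h2.
apply/eqP; rewrite eq_le h1 andbT; move: h2; lra.
Qed.

Lemma tproj_vi S x v w : S !=set0 -> segment_closed S ->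
  tangent_cone S x w -> dotv (v - tproj S x v) w <= 0.
Proof.
move=> S0 sS Tw; have T0 := tangent_cone0 x S0.
have Tne : tangent_cone S x !=set0 by exists 0.
have := eproj_vi v Tne (@closed_tangent_cone S x)
  (tangent_cone_segment_closed (x := x) sS) Tw.
by rewrite -/(tproj S x v) dotvDr dotvNr tproj_orth// subr0.
Qed.

(** The third condition, on the generators y - x, extends to the whole cone by
    scaling and closure. *)
Lemma tproj_unique S x v p : tangent_cone S x p -> dotv (v - p) p = 0 ->
  (forall y, S y -> dotv (v - p) (y - x) <= 0) -> tproj S x v = p.
Proof.
move=> Tp orth vi; apply: eproj_unique => // w /closure_enorm Tw.
rewrite dotvDr dotvNr orth subr0.
set q := v - p in vi *; apply/ler_addgt0Pr => e e0; rewrite add0r.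
have q1 : 0 < enorm q + 1 by rewrite ltr_wpDl ?enorm_ge0.
have [_ [d d0 [y Sy ->]] we] := Tw _ (divr_gt0 e0 q1).
have -> : dotv q w = d^-1 * dotv q (y - x) - dotv q (d^-1 *: (y - x) - w).
  by rewrite -dotvZr -dotvNr -dotvDr subKr.
have h1 : d^-1 * dotv q (y - x) <= 0.
  by rewrite pmulr_rle0 ?invr_gt0// vi.
have h2 := dotv_abs_le q (d^-1 *: (y - x) - w).
have h3 : enorm q * enorm (d^-1 *: (y - x) - w) <= e.
  rewrite ltr_pdivlMr// in we; apply: le_trans (ltW we); rewrite mulrC.
  by rewrite ler_wpM2l ?enorm_ge0// lerDl.
move: h2; rewrite ler_norml => /andP[h2 _]; lra.
Qed.

End projection.

(** * Lipschitz curves are differentiable almost everywhere *)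

Section lipschitz_ae.
Context {R : realType}.
Notation lambda := (@lebesgue_measure R).

Section with_cumulative.
Variables (G : cumulative R R) (K : R).
Hypothesis K0 : 0 < K.
Hypothesis GK : forall s t, s <= t -> G t - G s <= K * (t - s).

Let nu := lebesgue_stieltjes_measure G.

Lemma wlength_lip (X : set (ocitv_type R)) :
  measurable X -> (wlength G X <= K%:E * wlength idfun X)%E.
Proof.
move=> /ocitvP[->|[[u v /= uv ->]]]; first by rewrite !wlength0 mule0.
have uv' := ltW uv; rewrite !wlength_itv_bnd//.
exact/GK.
Qed.

(** A null set has covers by intervals of arbitrarily small total length. *)
Lemma stieltjes_dominated : nu `<< lambda.
Proof.
apply/null_content_dominatesP => A mA A0.
apply/eqP; rewrite eq_le measure_ge0 andbT.
apply/lee_addgt0Pr => e e0; rewrite add0e.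
have : (lambda A < (e / K)%:E)%E by rewrite A0 lte_fin divr_gt0.
rewrite /lebesgue_measure /lebesgue_stieltjes_measure /measure_extension.
move=> /ereal_inf_lt[_ [F [mF AF] <-] Fe].
apply: (@le_trans _ _ (\sum_(k <oo) wlength G (F k))%E).
  by apply: ereal_inf_lbound; exists F.
apply: (@le_trans _ _ (\sum_(k <oo) (K%:E * wlength idfun (F k)))%E).
  by apply: lee_nneseries => // i _; exact: wlength_lip.
rewrite nneseriesZl; last by move=> i _; exact: wlength_ge0.
have : (K%:E * \sum_(k <oo) wlength idfun (F k) <= K%:E * (e / K)%:E)%E.
  by rewrite lee_pmul2l// ltW.
by move=> /le_trans; apply; rewrite -EFinM lee_fin mulrC divfK// gt_eqF.
Qed.

Lemma stieltjes_itv (u v : R) : u <= v -> nu `]u, v]%classic = (G v - G u)%:E.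
Proof.
move=> uv; rewrite /nu /lebesgue_stieltjes_measure /measure_extension.
by rewrite measurable_mu_extE//=; [rewrite wlength_itv_bnd|exact: is_ocitv].
Qed.

(** On the bounded interval the Stieltjes measure is finite and absolutely
    continuous, so by Radon-Nikodym G is there, up to a constant, the integral
    of a density, and Lebesgue's differentiation theorem applies. *)
Lemma cumulative_ae_derivable (T : R) : 0 < T ->
  {ae lambda, forall x : R, (- T < x < T)%R -> derivable (G : R -> R) x 1}.
Proof.
move=> T0.
have TT : - T <= T by lra.
have nuoo : (nu `](- T)%R, T]%classic < +oo)%E by rewrite stieltjes_itv// ltry.
have mI : measurable (`]- T, T]%classic : set (measurableTypeR R)).
  exact: measurable_itv.
pose m : {finite_measure set (measurableTypeR R) -> \bar R} := mfrestr mI nuoo.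
have mlam : charge_of_finite_measure m `<< lambda.
  apply/null_content_dominatesP => A mA A0.
  rewrite /charge_of_finite_measure /m /= /mfrestr /mrestr.
  apply/eqP; rewrite eq_le measure_ge0 andbT.
  rewrite -((null_content_dominatesP _ _).1 stieltjes_dominated A mA A0).
  by apply: le_measure; rewrite ?inE//; exact: measurableI.
pose h := Radon_Nikodym (charge_of_finite_measure m) lambda.
have hfin x : h x \is a fin_num by exact: Radon_Nikodym_fin_num.
have hint : lambda.-integrable setT h by exact: Radon_Nikodym_integrable.
have hE A : measurable A -> m A = (\int[lambda]_(x in A) h x)%E.
  by move=> mA; rewrite -Radon_Nikodym_integral.
pose f x := fine (h x).
have fE : EFin \o f = h by apply/funext => x /=; rewrite fineK.
have fint : lambda.-integrable setT (EFin \o f) by rewrite fE.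
have fint' y : lambda.-integrable [set` `]-oo, y]] (EFin \o f).
  exact: integrableS fint.
have /(FTC1Ny fint') F1 : locally_integrable setT f.
  by apply: open_integrable_locally => //; exact: openT.
apply: (@filterS _ _ (ae_filter_ringOfSetsType lambda) _ _ _ F1).
move=> x [dx _] /andP[Tx xT].
have dx' : derivable (fun x : R => G x - G (- T)) x 1.
  apply: near_eq_derivable dx; near=> y.
  rewrite /Rintegral.
  under eq_integral do rewrite -/((EFin \o f) _) fE.
  rewrite -hE// /m/= /mfrestr/= /mrestr.
  have -> : `]-oo, y]%classic `&` `]- T, T]%classic = `](- T), y]%classic.
    apply/seteqP; split => z /=; rewrite !in_itv/=.
      by move=> [-> /andP[->]].
    move=> /andP[-> zy]; split=> //=; apply: le_trans zy _.
    by near: y; exact: lt_le_nbhsl.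
  rewrite -/nu stieltjes_itv//=.
  by near: y; exact: lt_le_nbhsr.
rewrite (_ : (G : R -> R) = (fun x => G x - G (- T)) + cst (G (- T))).
  by apply: derivableD.
by apply/funext => z /=; rewrite /GRing.add /= subrK.
Unshelve. all: by end_near. Qed.
End with_cumulative.

(** Adding K t makes g nondecreasing. *)
Lemma lipschitz_ae_derivable (K : R) (g : R -> R) : 0 < K ->
  (forall s t, `|g t - g s| <= K * `|t - s|) ->
  {ae lambda, forall x : R, derivable g x 1}.
Proof.
move=> K0 gK; pose G t := g t + K * t.
have Gnd : {homo G : s t / s <= t}.
  move=> s t st; have := gK s t; rewrite (ger0_norm (x := t - s)) ?subr_ge0//.
  by rewrite ler_norml /G => /andP[h _]; lra.
have GK s t : s <= t -> G t - G s <= (K *+ 2) * (t - s).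
  move=> st; have := gK s t; rewrite (ger0_norm (x := t - s)) ?subr_ge0//.
  by rewrite ler_norml /G mulr2n => /andP[_ h]; lra.
have Gc : continuous G.
  move=> x; apply: (@continuousD _ R^o); last first.
    by apply: (@continuousM _ R); [exact: cvg_cst|exact: cvg_id].
  apply/cvgrPdist_lt => e e0; near=> y.
  apply: (le_lt_trans (gK y x)); rewrite -ltr_pdivlMl// mulrC.
  by near: y; apply: (@cvgr_dist_lt _ R^o) => //; rewrite divr_gt0.
pose Gc' : cumulative R R := HB.pack_for (cumulative R R) G
  (isCumulative.Build R _ R G Gnd (right_continuousW Gc)).
have K20 : 0 < K *+ 2 by rewrite pmulrn_lgt0.
have D n := @cumulative_ae_derivable Gc' (K *+ 2) K20 GK n.+1%:R (ltr0Sn _ _).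
have := ae_foralln D.
apply: (@filterS _ _ (ae_filter_ringOfSetsType lambda)) => x dG.
have xn : - (Num.Def.archi_bound `|x|).+1%:R < x
    < (Num.Def.archi_bound `|x|).+1%:R.
  have : `|x| < (Num.Def.archi_bound `|x|).+1%:R.
    by apply: (lt_trans (archi_boundP (normr_ge0 x))); rewrite ltr_nat.
  by rewrite ltr_norml.
have := dG _ xn => /= dGx.
rewrite (_ : g = G - (K *: id)); last first.
  by apply/funext => t; rewrite /G !fctE /GRing.scale/= addrK.
exact: derivableB.
Unshelve. all: by end_near. Qed.
End lipschitz_ae.

(** * Absolutely continuous functions and Dini derivatives *)

Section absolute_continuity.
Context {R : realType}.
Implicit Types (a b s t e : R) (phi : R -> R).
Notation lambda := (@lebesgue_measure R).

Definition disjoint_family a b p (u v : 'I_p -> R) :=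
  (forall i, a <= u i /\ u i <= v i /\ v i <= b) /\
  trivIset setT (fun i => [set` `]u i, v i[]).

(** Absolute continuity of a nonnegative function of intervals.  It covers
    vector and scalar functions, and sums of their increments, at once. *)
Definition ac_increments a b (g : R -> R -> R) := forall e, 0 < e ->
  exists2 d : R, 0 < d &
  forall p (u v : 'I_p -> R), disjoint_family a b u v ->
    \sum_i (v i - u i) < d -> \sum_i g (u i) (v i) < e.

Definition ac_on a b phi := ac_increments a b (fun s t => `|phi t - phi s|).

Lemma abs_continuousP m a b (z : R -> 'cV[R]_m) :
  abs_continuous a b z <-> ac_increments a b (fun s t => enorm (z t - z s)).
Proof.
split=> acz e /acz[d d0 h]; exists d => // p u v; first
  by move=> [uv tuv]; exact: h.
by move=> uv tuv; exact: h.
Qed.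

Lemma ac_increments_control a b (g h : R -> R -> R) (A B : R) :
  0 <= A -> 0 <= B -> ac_increments a b g ->
  (forall s t, a <= s -> s <= t -> t <= b ->
    0 <= g s t /\ h s t <= A * g s t + B * (t - s)) ->
  ac_increments a b h.
Proof.
move=> A0 B0 acg ctrl e e0.
have A1 : 0 < A + 1 by lra.
have B1 : 0 < B + 1 by lra.
have e20 : 0 < e / 2 by rewrite divr_gt0.
have [d d0 dg] := acg _ (divr_gt0 e20 A1).
exists (Num.min d (e / 2 / (B + 1))); first by rewrite lt_min d0 divr_gt0.
move=> p u v [uv tuv]; rewrite lt_min => /andP[/(dg p u v (conj uv tuv)) h1 h2].
have : \sum_i h (u i) (v i) <=
    A * (\sum_i g (u i) (v i)) + B * (\sum_i (v i - u i)).
  rewrite !mulr_sumr -big_split/=; apply: ler_sum => i _.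
  by have [? [? ?]] := uv i; apply: (ctrl _ _ _ _ _).2.
move=> /le_lt_trans; apply.
set X := \sum_i g _ _ in h1 *; set Y := \sum_i _ in h2 *.
have X0 : 0 <= X.
  by apply: sumr_ge0 => i _; have [? [? ?]] := uv i; apply: (ctrl _ _ _ _ _).1.
have Y0 : 0 <= Y.
  by apply: sumr_ge0 => i _; rewrite subr_ge0; have [? [? ?]] := uv i.
rewrite !ltr_pdivlMr// in h1 h2.
have := h1; have := h2; lra.
Qed.

Lemma ac_increments_add a b (g h : R -> R -> R) :
  ac_increments a b g -> ac_increments a b h ->
  ac_increments a b (fun s t => g s t + h s t).
Proof.
move=> acg ach e e0; have e20 : 0 < e / 2 by rewrite divr_gt0.
have [d1 d10 g1] := acg _ e20; have [d2 d20 h2] := ach _ e20.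
exists (Num.min d1 d2); first by rewrite lt_min d10.
move=> p u v uv; rewrite lt_min => /andP[/(g1 p u v uv) + /(h2 p u v uv)].
by rewrite big_split/=; lra.
Qed.

Lemma ac_increments_id a b : ac_increments a b (fun s t => t - s).
Proof. by move=> e e0; exists e. Qed.

Lemma null_set_open_cover (N : set R) e : 0 < e -> lambda.-negligible N ->
  exists U : set R, [/\ open U, N `<=` U & (lambda U < e%:E)%E].
Proof.
move=> e0 [A [mA A0 NA]].
have Aoo : (lambda A < +oo)%E by rewrite A0 ltry.
have [U [oU AU Ue]] := lebesgue_regularity_outer mA Aoo e0.
exists U; split => //; first exact: subset_trans AU.
have mU : measurable U by exact: measurable_realfun.open_measurable.
apply: le_lt_trans Ue.
have UE : (U `\` A) `|` A = U by rewrite setUC setDUK.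
rewrite -{1}UE -[leRHS]adde0 -A0; apply: measureU2 => //.
exact: measurableD.
Qed.

(** Additivity of the Lebesgue measure on the disjoint intervals. *)
Lemma family_length_le p (u v : 'I_p -> R) (U : set R) :
  open U -> (forall i, u i <= v i) ->
  trivIset setT (fun i => [set` `]u i, v i[]) ->
  (forall i, [set` `]u i, v i[] `<=` U) ->
  ((\sum_i (v i - u i))%:E <= lambda U)%E.
Proof.
move=> oU uv tuv uvU.
have -> : (\sum_i (v i - u i))%:E = (\sum_(i < p) lambda [set` `]u i, v i[])%E.
  rewrite -sumEFin; apply: eq_bigr => i _.
  rewrite lebesgue_measure_itv/= lte_fin; case: ltP => [_|vu].
    by rewrite EFinB.
  by have := uv i => /(conj vu)/andP/le_anti ->; rewrite subrr.
rewrite -(measure_bigsetU_ord lambda xpredT) //.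
apply: le_measure; rewrite ?inE.
- by apply: bigsetU_measurable => i _; exact: measurable_itv.
- exact: measurable_realfun.open_measurable.
- apply: (big_ind (fun X => X `<=` U)); first exact: sub0set.
    by move=> A B AU BU; rewrite subUset.
  by move=> i _; exact: uvU.
Qed.

Lemma ac_continuous_left a b phi s e : ac_on a b phi -> a <= s -> s <= b ->
  0 < e -> exists2 d : R, 0 < d &
  forall t, a <= t -> t <= s -> s - t < d -> `|phi s - phi t| < e.
Proof.
move=> ac as_ sb e0; have [d d0 dphi] := ac e e0; exists d => // t at_ ts std.
have := dphi 1 (fun=> t) (fun=> s).
rewrite !big_ord1; apply => //; split=> [//|].
by move=> i j _ _; rewrite !ord1.
Qed.

(** The variations of phi over finite families of disjoint intervals of [a, s]
    lying in U.  In the next theorem U is a small neighborhood of the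
    exceptional null set, so that absolute continuity bounds all of them. *)
Definition family_variation (U : set R) a s phi (x : R) :=
  exists p, exists u, exists v : 'I_p -> R,
    [/\ disjoint_family a s u v, (forall i, [set` `]u i, v i[] `<=` U)
      & x = \sum_i `|phi (v i) - phi (u i)|].

Lemma family_variation_widen (U : set R) a s s' phi x : s <= s' ->
  family_variation U a s phi x -> family_variation U a s' phi x.
Proof.
move=> ss' [p [u [v [[uv tuv] uvU ->]]]]; exists p, u, v; split => //.
split=> // i; have [? [? vs]] := uv i; do 2!split => //.
exact: le_trans ss'.
Qed.

Lemma family_variation_extend (U : set R) a s s' phi x : a <= s -> s <= s' ->
  [set` `]s, s'[] `<=` U -> family_variation U a s phi x ->
  family_variation U a s' phi (x + `|phi s' - phi s|).
Proof.
move=> as_ ss' sU [p [u [v [[uv tuv] uvU ->]]]].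
exists p.+1, (fun i => oapp u s (unlift ord_max i)),
  (fun i => oapp v s' (unlift ord_max i)).
have wl (i : 'I_p) : widen_ord (leqnSn p) i = lift ord_max i.
  by apply: val_inj; rewrite /= /bump leqNgt ltn_ord.
split.
- split=> [i|].
    case: unliftP => [j _|_] /=; last by [].
    by have [? [? vs]] := uv j; do 2!split => //; exact: le_trans ss'.
  move=> i j _ _.
  case: unliftP => [i' ->|->]; case: unliftP => [j' ->|->] //=.
  + by move=> ij; congr lift; exact: tuv.
  + move=> [z []] /=; rewrite !in_itv/= => /andP[_ zv] /andP[sz _].
    have [_ [_ vs]] := uv i'.
    by have := lt_trans sz zv; rewrite ltNge vs.
  + move=> [z []] /=; rewrite !in_itv/= => /andP[sz _] /andP[_ zv].
    have [_ [_ vs]] := uv j'.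
    by have := lt_trans sz zv; rewrite ltNge vs.
- by move=> i; case: unliftP => [j _|_] /=.
- rewrite big_ord_recr/= unlift_none/=; congr (_ + _).
  by apply: eq_bigr => i _; rewrite wl liftK.
Qed.

(** Let U be an open set containing the exceptional times, so small that phi
    varies by less than e over families of intervals in U.  The inequality
      phi s - phi a <= e (s - a) + (a variation over a family in U)
    propagates to the right: at a time of U the next increment is added to the
    family, at the other times the Dini condition is used.  It is closed on the
    left by continuity, hence holds up to b; then let e tend to 0. *)
Theorem ac_nonincreasing a b phi : a <= b -> ac_on a b phi ->
  {ae lambda, forall t : R, (a <= t)%R -> (t < b)%R ->
     forall e : R, (0 < e)%R -> exists2 d : R, (0 < d)%R &
       forall s, (t < s)%R -> (s < t + d)%R ->
         (phi s - phi t <= e * (s - t))%R} ->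
  phi b <= phi a.
Proof.
move=> ab ac dini; rewrite -subr_le0.
have drop e : 0 < e -> phi b - phi a <= e * (b - a) + e + e.
  move=> e0; have [d d0 dphi] := ac e e0.
  have [U [oU NU Ud]] := null_set_open_cover d0 dini.
  (* The slack eta replaces the supremum of the variations. *)
  pose P s := forall eta, 0 < eta -> exists2 x, family_variation U a s phi x &
    phi s - phi a <= e * (s - a) + x + eta.
  pose S := [set s | a <= s /\ s <= b /\ P s].
  have Sa : S a.
    split=> //; split=> // eta eta0; exists 0; last by lra.
    exists 0%N, (fun=> 0), (fun=> 0); split.
    - by split=> [[]//|[]].
    - by case.
    - by rewrite big_ord0.
  have supS : has_sup S.
    by split; [exists a|exists b => s [_ []]].
  set c := sup S.
  have ac' : a <= c by exact: sup_upper_bound.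
  have cb : c <= b by apply: sup_le_ub; [exists a|move=> s [_ []]].
  have Pc : P c.
    move=> eta eta0; have e20 : 0 < eta / 2 by rewrite divr_gt0.
    have [d' d'0 d'phi] := ac_continuous_left ac ac' cb e20.
    have [s [as_ [sb Ps]] cs] := sup_adherent d'0 supS.
    have sc : s <= c by apply: sup_upper_bound.
    have [x fx xs] := Ps _ e20.
    exists x; first exact: family_variation_widen fx.
    have csd : c - s < d' by move: cs; rewrite -/c; lra.
    have := d'phi s as_ sc csd; rewrite ltr_norml => /andP[_].
    have : e * (s - a) <= e * (c - a) by rewrite ler_pM2l//; lra.
    lra.
  have cE : c = b.
    apply/eqP; rewrite eq_le cb /= leNgt; apply/negP => cltb.
    have [s cs [sb Ps]] : exists2 s, c < s & s <= b /\ P s.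
      have [Uc|nUc] := pselect (U c).
        have /nbhs_ballP[r /= r0 rU] : nbhs c U by exact: open_nbhs_nbhs.
        pose s := Num.min b (c + r / 2).
        have cs : c < s by rewrite lt_min cltb ltrDl divr_gt0.
        have sb : s <= b by rewrite ge_min lexx.
        have sr : s <= c + r / 2 by rewrite ge_min lexx orbT.
        exists s => //; split=> // eta eta0.
        have [x fx xc] := Pc _ eta0.
        exists (x + `|phi s - phi c|).
          apply: family_variation_extend => //; first exact: ltW.
          move=> z /=; rewrite in_itv/= => /andP[cz zs]; apply: rU.
          rewrite /ball/= ltr_norml; apply/andP; split; lra.
        have := ler_norm (phi s - phi c).
        have : e * (c - a) <= e * (s - a) by rewrite ler_pM2l//; lra.
        lra.
      have := contra_not (NU c) nUc;
        move=> /contrapT/(_ ac' cltb e e0)[d' d'0 h].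
      pose s := Num.min b (c + d' / 2).
      have cs : c < s by rewrite lt_min cltb ltrDl divr_gt0.
      have sb : s <= b by rewrite ge_min lexx.
      have sr : s <= c + d' / 2 by rewrite ge_min lexx orbT.
      exists s => //; split=> // eta eta0.
      have [x fx xc] := Pc _ eta0.
      exists x; first by apply: family_variation_widen fx; exact: ltW.
      have := h s cs; move=> /(_ _); have : s < c + d' by lra.
      move=> sd /(_ sd); lra.
    have : s <= c by apply: sup_upper_bound => //; split; [lra|].
    lra.
  have [x [p [u [v [[uv tuv] uvU ->]]]] xb] := Pc e e0; rewrite -cE.
  have lt_e : \sum_i `|phi (v i) - phi (u i)| < e.
    apply: dphi.
      split=> // i; have [? [? ?]] := uv i; do 2!split => //.
      exact: le_trans cb.
    rewrite -lte_fin; apply: le_lt_trans Ud; apply: family_length_le => // i.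
    by have [? [? ?]] := uv i.
  lra.
apply/ler_addgt0Pr => e e0; rewrite add0r.
have k0 : 0 < b - a + 2 by lra.
have := drop _ (divr_gt0 e0 k0).
set f := e / _; have fE : f * (b - a + 2) = e by rewrite /f divfK ?gt_eqF.
move: fE; lra.
Qed.

End absolute_continuity.

(** * Derivatives of curves *)

Section derive_enorm.
Context {R : realType} {m : nat}.
Implicit Types (z : R -> 'cV[R]_m) (t : R) (w : 'cV[R]_m).

(** First-order expansion in the Euclidean norm, the form in which derivatives
    are used below. *)
Lemma is_derive_enorm z t w : is_derive t (1 : R) z w <->
  forall e : R, 0 < e -> exists2 d : R, 0 < d & forall s, `|s - t| < d ->
    enorm (z s - z t - (s - t) *: w) <= e * `|s - t|.
Proof.
pose q h := h^-1 *: ((z \o shift t) (h *: (1 : R)) - z t).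
have H : is_derive t (1 : R) z w <-> q @ 0^' --> w.
  split=> [[dz <-]//|qw].
  by split; [apply/cvg_ex; exists w|exact: cvg_lim].
apply: (iff_trans H); apply: (iff_trans (cvg_enorm _ _)).
have key h : h != 0 ->
    enorm (z (h + t) - z t - h *: w) = `|h| * enorm (q h - w).
  move=> h0; rewrite -enormZ scalerBr /q /= scalerA divff// scale1r.
  by rewrite /GRing.scale/= mulr1.
split=> qw e e0.
  have /nbhs_ballP[d /= d0 dq] := qw e e0; exists d => // s sd.
  have [->|st] := eqVneq s t.
    by rewrite !subrr scale0r subr0 enorm0 normr0 mulr0.
  have h0 : s - t != 0 by rewrite subr_eq0.
  have := key _ h0; rewrite subrK => ->; rewrite mulrC ler_wpM2r//.
  by apply/ltW/dq => //; rewrite /ball/= sub0r normrN.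
have e20 : 0 < e / 2 by rewrite divr_gt0.
have [d d0 dq] := qw _ e20; apply/nbhs_ballP; exists d => // h.
rewrite /ball/= sub0r normrN => hd h0.
have := dq (h + t); rewrite addrK => /(_ hd);
  rewrite key// mulrC ler_pM2r ?normr_gt0//.
by move=> /le_lt_trans; apply; rewrite ltr_pdivrMr// ltr_pMr// ltr1n.
Qed.

Lemma lipschitz_curve_ae_derivable z (K : R) : 0 < K ->
  (forall s t, enorm (z t - z s) <= K * `|t - s|) ->
  {ae @lebesgue_measure R, forall t : R, exists w, is_derive t (1 : R) z w}.
Proof.
move=> K0 zK.
have Dc (i : 'I_m) : {ae @lebesgue_measure R, forall t : R,
    derivable (fun s => z s i 0) t 1}.
  apply: (lipschitz_ae_derivable K0) => s t.
  by apply: le_trans (zK s t); apply: le_trans (coord_le_enorm _ i);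
    rewrite !mxE.
have : {ae @lebesgue_measure R, forall t : R, forall n : nat,
    if insub n is Some i then
      derivable (fun s => z s (i : 'I_m) 0) t 1 else True}.
  apply/ae_foralln => n; case: insubP => [i _ _|_]; first exact: Dc.
  exact: aeW.
apply: (@filterS _ _ (ae_filter_ringOfSetsType (@lebesgue_measure R))) => t dt.
have dz : derivable z t 1.
  apply/derivable_mxP => i j; rewrite ord1.
  by have := dt i; rewrite valK.
by exists ('D_1 z t); exact: derivableP.
Qed.

End derive_enorm.

(** * Existence by the projected Euler scheme *)

Section cvg_euclid.
Context {R : realType} {m : nat} {T : Type} {F : set_system T} {FF : Filter F}.

Lemma cvg_dotv (u v : T -> 'cV[R]_m) (a b : 'cV[R]_m) :
  u x @[x --> F] --> a -> v x @[x --> F] --> b ->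
  dotv (u x) (v x) @[x --> F] --> dotv a b.
Proof.
have coord (w : T -> 'cV[R]_m) (c : 'cV[R]_m) i :
    w x @[x --> F] --> c -> w x i 0 @[x --> F] --> c i 0.
  move=> /cvg_enorm h; apply/cvgrPdist_lt => e /h; apply: filterS => x.
  by apply: le_lt_trans; apply: le_trans (coord_le_enorm _ i);
    rewrite !mxE distrC.
move=> ua vb; under eq_fun do rewrite dotvE; rewrite dotvE.
apply: cvg_big => [|i _]; last by apply: cvgM; exact: coord.
exact: add_continuous.
Qed.

End cvg_euclid.

(** The number of grid points between s and t, times h, is t - s up to h. *)
Lemma grid_gap {R : realFieldType} (s t p q h : R) :
  p * h <= s -> s < (p + 1) * h -> q * h <= t -> t < (q + 1) * h ->
  `|t - s - (q - p) * h| <= h.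
Proof.
move=> s1 s2 t1 t2; rewrite ler_norml; apply/andP.
by split; lra.
Qed.

Section sweeping_process.
Context {R : realType} {m : nat}.
Variables (C : set 'cV[R]_m) (f : 'cV[R]_m -> 'cV[R]_m) (z0 : 'cV[R]_m).
Variables (L B D : R).
Hypothesis Cclosed : closed C.
Hypothesis Ccvx : segment_closed C.
Hypothesis Cz0 : C z0.
Hypothesis CD : forall x y, C x -> C y -> enorm (x - y) <= D.
Hypothesis fL : forall x y, C x -> C y ->
  enorm (f x - f y) <= L * enorm (x - y).
Hypothesis fB : forall x, C x -> enorm (f x) <= B.
Hypothesis L0 : 0 <= L.

Let C0 : C !=set0. Proof. by exists z0. Qed.
Let B0 : 0 <= B. Proof. by apply: le_trans (fB Cz0); exact: enorm_ge0. Qed.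
Let D0 : 0 <= D. Proof. by apply: le_trans (CD Cz0 Cz0); exact: enorm_ge0. Qed.

Definition euler (h : R) (n : nat) : 'cV[R]_m :=
  iter n (fun x => eproj C (x + h *: f x)) z0.

Lemma euler_in h n : C (euler h n).
Proof. by case: n => [//|n]; apply: (eprojP _ C0 Cclosed).1. Qed.

(** Projecting on C brings x + h f x closer to y; expand the square. *)
Lemma euler_step h n y : C y ->
  dotv (euler h n.+1 - y) (euler h n.+1 - y) <=
  dotv (euler h n - y) (euler h n - y) +
  2 * h * dotv (f (euler h n)) (euler h n - y) + h ^+ 2 * B ^+ 2.
Proof.
move=> Cy; set x := euler h n.
have := eproj_nonexp_to (x + h *: f x) C0 Cclosed Ccvx Cy.
rewrite -/(euler h n.+1) le_enorm_sqr => /le_trans; apply.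
rewrite addrAC [leLHS]dotv_sqrD dotvZl !dotvZr (dotvC (x - y) (f x)).
have : dotv (f x) (f x) <= B ^+ 2.
  by rewrite -enorm_sqr lerXn2r ?nnegrE ?enorm_ge0//; apply/fB/euler_in.
have : 0 <= h ^+ 2 by exact: sqr_ge0.
by move=> h2 fx; have := ler_wpM2l h2 fx; lra.
Qed.

Lemma euler_move1 h n : 0 <= h -> enorm (euler h n.+1 - euler h n) <= h * B.
Proof.
move=> h0; apply: enorm_le_sqr; first exact: mulr_ge0.
have := euler_step h n (euler_in h n).
by rewrite !subrr !dotv0r mulr0 !add0r exprMn.
Qed.

Lemma euler_move h n k : 0 <= h ->
  enorm (euler h (n + k) - euler h n) <= k%:R * h * B.
Proof.
move=> h0; elim: k => [|k IH]; first by rewrite addn0 subrr enorm0 !mul0r.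
rewrite addnS; apply: (le_trans (enorm_dist _ (euler h (n + k)) _)).
by have := euler_move1 (n + k) h0; rewrite -[k.+1]addn1 natrD; lra.
Qed.

Let Q := (L * D + B) * B.

(** Both factors of <f x, x - y> are bounded and Lipschitz on C. *)
Lemma drift_lipschitz x x' y : C x -> C x' -> C y ->
  dotv (f x) (x - y) <= dotv (f x') (x' - y) + (L * D + B) * enorm (x - x').
Proof.
move=> Cx Cx' Cy.
have -> : dotv (f x) (x - y) =
    dotv (f x') (x' - y) + dotv (f x - f x') (x - y) + dotv (f x') (x - x').
  by rewrite -(subrKA x' x) !dotvDr !dotvDl !dotvNl; ring.
have h1 := dotv_le_enorm (f x - f x') (x - y).
have h2 := dotv_le_enorm (f x') (x - x').
have h3 : enorm (f x') * enorm (x - x') <= B * enorm (x - x').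
  by rewrite ler_wpM2r ?enorm_ge0// fB.
have h4 : enorm (f x - f x') * enorm (x - y) <= L * enorm (x - x') * D.
  by apply: ler_pM; rewrite ?enorm_ge0 ?fL ?CD.
lra.
Qed.

(** Sum [euler_step] over k steps.  The drift at step i differs from the initial
    one by at most Q i h, which contributes to the term in Q (k h)^2. *)
Lemma euler_evi h n k y : 0 <= h -> C y ->
  dotv (euler h (n + k) - y) (euler h (n + k) - y) <=
  dotv (euler h n - y) (euler h n - y) +
  2 * (k%:R * h) * dotv (f (euler h n)) (euler h n - y) +
  2 * Q * (k%:R * h) ^+ 2 + k%:R * h * h * B ^+ 2.
Proof.
move=> h0 Cy; elim: k => [|k IH].
  by rewrite addn0 !mul0r expr0n /= !mulr0 mul0r !addr0.
rewrite addnS; apply: (le_trans (euler_step h (n + k) Cy)).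
have dl := drift_lipschitz (euler_in h (n + k)) (euler_in h n) Cy.
have mv := euler_move n k h0.
have q0 : 0 <= L * D + B by rewrite addr_ge0// mulr_ge0.
have h1 : (L * D + B) * enorm (euler h (n + k) - euler h n) <= Q * (k%:R * h).
  by apply: le_trans (ler_wpM2l q0 mv) _; rewrite /Q; lra.
have h2 := ler_wpM2l h0 (le_trans dl (lerD (lexx _) h1)).
have k0 : 0 <= k%:R :> R by [].
have Q0 : 0 <= Q by rewrite mulr_ge0.
have h3 : 0 <= Q * h ^+ 2 by rewrite mulr_ge0 ?sqr_ge0.
have h4 : 0 <= k%:R * (Q * h ^+ 2) by rewrite mulr_ge0.
rewrite -[k.+1]addn1 natrD /= in IH *.
rewrite !exprMn in IH *; rewrite sqrrD expr1n.
move: IH h2 h3 h4; set X := dotv (f _) (euler h n - y).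
set Y := dotv (f (euler h (n + k))) _.
set k' := (k%:R : R) => IH h2 h3 h4.
have -> : 2 * ((k' + 1) * h) * X = 2 * (k' * h) * X + 2 * (h * X) by ring.
have -> : 2 * Q * ((k' ^+ 2 + k' * 1 *+ 2 + 1) * h ^+ 2) =
  2 * Q * (k' ^+ 2 * h ^+ 2) + 2 * (h * (Q * (k' * h))) +
   2 * (k' * (Q * h ^+ 2)) + 2 * (Q * h ^+ 2) by ring.
have -> : (k' + 1) * h * h * B ^+ 2 = k' * h * h * B ^+ 2 + h ^+ 2 * B ^+ 2.
  by ring.
have h5 : h * Y <= h * X + h * (Q * (k' * h)) by rewrite -mulrDr.
lra.
Qed.

Let hN (n : nat) : R := n.+1%:R^-1.
Let sample n (t : R) := euler (hN n) (Num.trunc (t / hN n)).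

Let compactC : compact C.
Proof.
apply: (@enorm_bounded_closed_compact _ _ _ (D + enorm z0)) => // u Cu.
have := enorm_dist u z0 0; rewrite !subr0 => /le_trans; apply.
by rewrite lerD2r CD.
Qed.

(** A cluster point in the compact set C of the images of an ultrafilter is a
    limit of it. *)
Lemma ultra_limit (U : set_system nat) (FU : UltraFilter U) t :
  exists2 p, C p & sample n t @[n --> U] --> p.
Proof.
have UC : U [set n | C (sample n t)].
  by apply: filterS filterT => n _; exact: euler_in.
have [p [Cp clp]] := @compactC (sample n t @[n --> U]) _ UC.
exists p => // A pA.
have [//|nA] := in_ultra_setVsetC ((sample ^~ t) @^-1` A) FU.
by have [q [nAq Aq]] := clp (~` A) A nA pA.
Qed.

(** Limit of [euler_evi] along an ultrafilter of step sizes: convergence at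
    every time costs nothing, by compactness, and the grid increment k h tends
    to t - s. *)
Lemma evi_existence : exists (z : R -> 'cV[R]_m) (K : R),
  [/\ 0 <= K, z 0 = z0, (forall t, C (z t)) &
  forall (s t : R) (y : 'cV[R]_m), 0 <= s -> s <= t -> C y ->
    dotv (z t - y) (z t - y) <= dotv (z s - y) (z s - y) +
      2 * (t - s) * dotv (f (z s)) (z s - y) + K * (t - s) ^+ 2].
Proof.
have [U [FU ooU]] := @ultraFilterLemma nat \oo _.
have /choice[z zP] : forall t, exists p, C p /\ sample n t @[n --> U] --> p.
  by move=> t; have [p Cp pp] := ultra_limit FU t; exists p.
have Uh : hN n @[n --> U] --> (0 : R).
  by apply: cvg_trans (@cvg_harmonic R) => A /ooU.
exists z, (2 * Q); split.
- by rewrite mulr_ge0// mulr_ge0// addr_ge0// mulr_ge0.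
- have /cvg_enorm h := (zP 0).2.
  apply/eqP; rewrite -subr_eq0; apply/eqP/enorm_eq0/eqP.
  rewrite eq_le enorm_ge0 andbT; apply/ler_addgt0Pr => e /h/filter_ex[n].
  by rewrite /sample mul0r truncn0 /= enormB add0r => /ltW.
- by move=> t; have [] := zP t.
- move=> s t y s0 st Cy.
  have [Cs zs] := zP s; have [Ct zt] := zP t.
  pose k n := (Num.trunc (t / hN n) - Num.trunc (s / hN n))%N.
  have hN0 n : 0 < hN n by rewrite invr_gt0.
  have kh : (k n)%:R * hN n @[n --> U] --> t - s.
    apply/cvgrPdist_lt => e e0.
    have /cvgrPdist_lt/(_ e e0) := Uh; apply: filterS => n.
    rewrite sub0r normrN gtr0_norm//; apply: le_lt_trans.
    have sh0 : 0 <= s / hN n by rewrite divr_ge0// ltW.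
    have th0 : 0 <= t / hN n by apply: divr_ge0;
      [exact: le_trans st|exact: ltW].
    have /andP[s1 s2] := truncn_itv sh0.
    have /andP[t1 t2] := truncn_itv th0.
    have le_ : (Num.trunc (s / hN n) <= Num.trunc (t / hN n))%N.
      by apply: le_truncn; rewrite ler_pM2r ?invr_gt0.
    rewrite natrB//; move: s1 s2 t1 t2; rewrite -!natr1.
    rewrite ler_pdivlMr// ltr_pdivrMr// ler_pdivlMr// ltr_pdivrMr//.
    set p := (_%:R : R); set q := (_%:R : R); set h := hN n => s1 s2 t1 t2.
    exact: grid_gap.
  have fzs : f (sample n s) @[n --> U] --> f (z s).
    apply/cvg_enorm => e e0; have L1 : 0 < L + 1 by rewrite ltr_wpDl.
    have /cvg_enorm/(_ _ (divr_gt0 e0 L1)) := zs; apply: filterS => n.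
    rewrite ltr_pdivlMr// => h; apply: le_lt_trans h.
    apply: le_trans (fL (euler_in _ _) Cs) _.
    by have := enorm_ge0 (sample n s - z s); rewrite /sample; lra.
  have zsy : sample n s - y @[n --> U] --> z s - y
    by apply: cvgB => //; exact: cvg_cst.
  have zty : sample n t - y @[n --> U] --> z t - y
    by apply: cvgB => //; exact: cvg_cst.
  apply: (@ler_cvg_to _ U _ _ (fun n => dotv (sample n t - y) (sample n t - y))
    (fun n => dotv (sample n s - y) (sample n s - y) +
      2 * ((k n)%:R * hN n) * dotv (f (sample n s)) (sample n s - y) +
      2 * Q * ((k n)%:R * hN n) ^+ 2 + (k n)%:R * hN n * hN n * B ^+ 2)).
  + exact: cvg_dotv.
  + rewrite -[X in _ --> X]addr0; apply: cvgD; last first.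
      rewrite -[X in _ --> X](mul0r (B ^+ 2)); apply: cvgM; last exact: cvg_cst.
      by rewrite -[X in _ --> X](mulr0 (t - s)); exact: cvgM.
    apply: cvgD; last first.
      apply: cvgM; first exact: cvg_cst.
      by rewrite expr2; under eq_fun do rewrite expr2; exact: cvgM.
    apply: cvgD; first exact: cvg_dotv.
    apply: cvgM; last exact: cvg_dotv.
    by apply: cvgM => //; exact: cvg_cst.
  + apply: nearW => n; rewrite /sample.
    have nk : Num.trunc (t / hN n) = (Num.trunc (s / hN n) + k n)%N.
      by rewrite subnKC//; apply: le_truncn; rewrite ler_pM2r ?invr_gt0.
    by rewrite {1 2}nk; apply: euler_evi => //; exact: ltW.
Qed.

End sweeping_process.

Section evi_consequences.
Context {R : realType} {m : nat}.
Variables (C : set 'cV[R]_m) (f : 'cV[R]_m -> 'cV[R]_m) (z : R -> 'cV[R]_m).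
Variable (K : R).
Hypothesis K0 : 0 <= K.
Hypothesis zC : forall t, C (z t).
Hypothesis zevi : forall (s t : R) (y : 'cV[R]_m), 0 <= s -> s <= t -> C y ->
  dotv (z t - y) (z t - y) <= dotv (z s - y) (z s - y) +
    2 * (t - s) * dotv (f (z s)) (z s - y) + K * (t - s) ^+ 2.

(** Take y = z s. *)
Lemma evi_lipschitz (s t : R) : 0 <= s -> 0 <= t ->
  enorm (z t - z s) <= (Num.sqrt K + 1) * `|t - s|.
Proof.
wlog st : s t / s <= t => [H s0 t0|s0 t0].
  have [st|/ltW ts] := leP s t; first exact: H.
  by rewrite enormB distrC; exact: H.
rewrite ger0_norm ?subr_ge0//.
have : enorm (z t - z s) <= Num.sqrt K * (t - s).
  apply: enorm_le_sqr; first by rewrite mulr_ge0 ?sqrtr_ge0 ?subr_ge0.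
  have := zevi s0 st (zC s).
  by rewrite !subrr !dotv0r mulr0 !add0r exprMn sqr_sqrtr.
by move=> /le_trans; apply; rewrite ler_wpM2r ?subr_ge0// lerDl.
Qed.

(** Compare the two first-order expansions in h of |z (t + h) - y|^2: the one
    given by the derivative w, and the upper bound with drift f (z t). *)
Lemma evi_velocity (t : R) (w y : 'cV[R]_m) : 0 <= t ->
  is_derive t (1 : R) z w -> C y ->
  dotv (f (z t) - w) (y - z t) <= 0.
Proof.
move=> t0 /is_derive_enorm dz Cy; set a := z t - y.
have Na : 0 < 2 * enorm a + K + 1.
  by have := enorm_ge0 a; move: (K0); lra.
suff : dotv w a <= dotv (f (z t)) a.
  by rewrite -(opprB (z t) y) -/a dotvNr dotvDl dotvNl; lra.
apply/ler_addgt0Pr => e e0.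
pose e' := e / (2 * enorm a + K + 1).
have e'0 : 0 < e' by rewrite divr_gt0.
have [d d0 dzd] := dz _ e'0.
pose h := Num.min (d / 2) e'.
have h0 : 0 < h by rewrite lt_min e'0 divr_gt0.
have hd : h < d.
  by rewrite (@le_lt_trans _ _ (d / 2))// ?ge_min ?lexx// ltr_pdivrMr//
    ltr_pMr// ltr1n.
have he : h <= e' by rewrite ge_min lexx orbT.
have := dzd (t + h); rewrite addrAC subrr add0r (ger0_norm (ltW h0)) => /(_ hd).
set r := (z (t + h) - z t - h *: w) => rb.
have zth : z (t + h) - y = a + (h *: w + r).
  by rewrite /r /a addrC -[RHS]addrA addrC; apply/matrixP => i j;
    rewrite !mxE; ring.
have := zevi t0 (_ : t <= t + h) Cy; rewrite lerDl => /(_ (ltW h0)).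
rewrite -/a zth [leLHS]dotv_sqrD (dotvDr (h *: w) r a) dotvZr (dotvC a w)
  (addrAC t h) subrr add0r.
have := dotv_ge0 (h *: w + r).
have := dotv_abs_le a r; rewrite ler_norml => /andP[ar _].
have ar2 : enorm a * enorm r <= enorm a * (e' * h).
  by rewrite ler_wpM2l// enorm_ge0.
move=> p1 p2.
have : h * (2 * (dotv w a - dotv (f (z t)) a)) <=
  h * (2 * enorm a * e' + K * h).
  by rewrite expr2 in p2; lra.
rewrite ler_pM2l// => p3.
have p4 : K * h <= K * e' by rewrite ler_wpM2l.
have p5 : e' * (2 * enorm a + K + 1) = e by rewrite /e' divfK// gt_eqF.
lra.
Qed.

Lemma curve_tangent (S : set 'cV[R]_m) (t : R) (w : 'cV[R]_m) : 0 <= t ->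
  is_derive t (1 : R) z w -> (forall s : R, 0 <= s -> S (z s)) ->
  tangent_cone S (z t) w.
Proof.
move=> t0 /is_derive_enorm dz Sz; apply/closure_enorm => e e0.
have e20 : 0 < e / 2 by rewrite divr_gt0.
have [d d0 dzd] := dz _ e20.
have h0 : 0 < d / 2 by rewrite divr_gt0.
have hd : d / 2 < d by rewrite ltr_pdivrMr// ltr_pMr// ltr1n.
exists ((d / 2)^-1 *: (z (t + d / 2) - z t)).
  by exists (d / 2) => //; exists (z (t + d / 2)) => //; apply: Sz;
    rewrite addr_ge0// ltW.
have := dzd (t + d / 2); rewrite addrAC subrr add0r (ger0_norm (ltW h0)) =>
  /(_ hd).
set h := d / 2 in h0 hd *.
have -> : z (t + h) - z t - h *: w = h *: (h^-1 *: (z (t + h) - z t) - w).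
  by rewrite scalerBr scalerA divff ?gt_eqF// scale1r.
rewrite enormZ (ger0_norm (ltW h0)) mulrC ler_pM2r// => /le_lt_trans; apply.
by rewrite ltr_pdivrMr// ltr_pMr// ltr1n.
Qed.

(** For t > 0 both w and - w are limits of directions (z s - z t) / |s - t|, on
    which g is nonpositive. *)
Lemma velocity_orthogonal (t : R) (w g : 'cV[R]_m) : 0 < t ->
  is_derive t (1 : R) z w ->
  (forall y, C y -> dotv g (y - z t) <= 0) -> dotv g w = 0.
Proof.
move=> t0 /is_derive_enorm dz vi.
have Ng : 0 < enorm g + 1 by rewrite ltr_wpDl ?enorm_ge0.
have key (e : R) : 0 < e -> `|dotv g w| <= e.
  move=> e0; have e'0 : 0 < e / (enorm g + 1) by rewrite divr_gt0.
  have [d d0 dzd] := dz _ e'0.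
  pose h := Num.min (d / 2) t.
  have h0 : 0 < h by rewrite lt_min t0 divr_gt0.
  have hd : h < d.
    by rewrite (@le_lt_trans _ _ (d / 2))// ?ge_min ?lexx// ltr_pdivrMr//
      ltr_pMr// ltr1n.
  have side (c : R) : `|c| = h -> c * dotv g w <= h * e.
    move=> ch; have := dzd (t + c); rewrite addrAC subrr add0r ch => /(_ hd).
    set r := _ - _ *: w => rb.
    have : dotv g (z (t + c) - z t) <= 0 by exact: vi.
    have -> : z (t + c) - z t = r + c *: w by rewrite subrK.
    rewrite dotvDr dotvZr => p1.
    have := dotv_abs_le g r; rewrite ler_norml => /andP[p2 _].
    have : enorm g * enorm r <= (enorm g + 1) * (e / (enorm g + 1) * h).
      by apply: ler_pM; rewrite ?enorm_ge0// lerDl.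
    rewrite mulrA [_ * (e / _)]mulrC divfK ?gt_eqF//; lra.
  have := side h (ger0_norm (ltW h0)); rewrite ler_pM2l// => p1.
  have := side (- h); rewrite normrN => /(_ (ger0_norm (ltW h0))).
  rewrite mulNr -mulrN ler_pM2l// => p2.
  by rewrite ler_norml; apply/andP; split; lra.
apply/eqP; rewrite -normr_eq0 eq_le normr_ge0 andbT.
by apply/ler_addgt0Pr => e /key; rewrite add0r.
Qed.

End evi_consequences.

(** Divide [s, t] into n equal parts: the total slack K (t - s)^2 / n
    vanishes. *)
Lemma quadratic_slack_nonincreasing {R : realType} (phi : R -> R) (K : R) :
  0 <= K ->
  (forall s t : R, 0 <= s -> s <= t -> phi t <= phi s + K * (t - s) ^+ 2) ->
  forall s t : R, 0 <= s -> s <= t -> phi t <= phi s.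
Proof.
move=> K0 slack s t s0 st.
have step n (h : R) : 0 <= h ->
    phi (s + n%:R * h) <= phi s + n%:R * (K * h ^+ 2).
  move=> h0; elim: n => [|n IH]; first by rewrite !mul0r !addr0.
  have sn : 0 <= s + n%:R * h by rewrite addr_ge0// mulr_ge0.
  have nn : s + n%:R * h <= s + n.+1%:R * h
    by rewrite lerD2l ler_wpM2r// ler_nat.
  apply: (le_trans (slack _ _ sn nn)).
  have -> : s + n.+1%:R * h - (s + n%:R * h) = h by rewrite -natr1; ring.
  by rewrite -natr1 mulrDl mul1r addrA lerD2r.
apply/ler_addgt0Pr => e e0.
pose a := K * (t - s) ^+ 2.
have a0 : 0 <= a by rewrite mulr_ge0 ?sqr_ge0.
pose n := (Num.Def.archi_bound (a / e)).+1.
have n0 : (0 : R) < n%:R by rewrite ltr0n.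
have an : a / e < n%:R.
  apply: (lt_trans (archi_boundP _)); first by rewrite divr_ge0// ltW.
  by rewrite ltr_nat.
have := step n ((t - s) / n%:R) (divr_ge0 _ _).
rewrite subr_ge0 => /(_ st (ltW n0)).
rewrite mulrC divfK ?gt_eqF// [s + _]addrC subrK => /le_trans; apply.
rewrite lerD2l.
have -> : n%:R * (K * ((t - s) / n%:R) ^+ 2) = a / n%:R.
  by rewrite /a; field; rewrite gt_eqF.
by rewrite ler_pdivrMr// mulrC -ler_pdivrMr// ltW.
Qed.

(** * Invariance and Gronwall estimates *)

Section dini_consequences.
Context {R : realType} {m : nat}.
Notation lambda := (@lebesgue_measure R).
Implicit Types (z : R -> 'cV[R]_m) (p w : 'cV[R]_m).

(** First-order upper bound for the squared distance to a fixed point; only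
    times to the right of t are needed for [ac_nonincreasing]. *)
Lemma sqdist_dini z (t : R) w p (e : R) : 0 < e -> is_derive t (1 : R) z w ->
  exists2 d : R, 0 < d & forall s, t < s -> s < t + d ->
    dotv (z s - p) (z s - p) <= dotv (z t - p) (z t - p) +
      (2 * dotv (z t - p) w + e) * (s - t).
Proof.
move=> e0 /is_derive_enorm dz; set a := z t - p.
have N0 : 0 < 2 * enorm a + 1 by have := enorm_ge0 a; lra.
have e20 : 0 < e / 2 by rewrite divr_gt0.
have e'0 : 0 < Num.min 1 (e / 2 / (2 * enorm a + 1)).
  by rewrite lt_min ltr01 divr_gt0.
set e' := Num.min _ _ in e'0.
have e'1 : e' <= 1 by rewrite ge_min lexx.
have e'e : e' * (2 * enorm a + 1) <= e / 2.
  by rewrite -ler_pdivlMr// ge_min lexx orbT.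
have [d d0 dzd] := dz _ e'0.
have W0 : 0 < (enorm w + 1) ^+ 2.
  by rewrite exprn_gt0// ltr_wpDl ?enorm_ge0.
exists (Num.min d (e / 2 / (enorm w + 1) ^+ 2)); first
  by rewrite lt_min d0 divr_gt0.
move=> s ts; rewrite -ltrBlDl lt_min => /andP[sd se].
have h0 : 0 < s - t by rewrite subr_gt0.
have := dzd s; rewrite gtr0_norm// => /(_ sd).
set h := s - t in sd se h0 *.
set r := z s - z t - h *: w => rb.
have zsE : z s - p = a + (h *: w + r).
  by rewrite /r /a; apply/matrixP => i j; rewrite !mxE; ring.
have nb : enorm (h *: w + r) <= (enorm w + 1) * h.
  apply: (le_trans (enormD _ _)); rewrite enormZ gtr0_norm//.
  have : e' * h <= 1 * h by rewrite ler_wpM2r// ltW.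
  lra.
have nb2 : dotv (h *: w + r) (h *: w + r) <= e / 2 * h.
  have : dotv (h *: w + r) (h *: w + r) <= ((enorm w + 1) * h) ^+ 2.
    rewrite -enorm_sqr lerXn2r ?nnegrE ?enorm_ge0//.
    exact: le_trans (enorm_ge0 _) nb.
  move=> /le_trans; apply; rewrite exprMn expr2 mulrA ler_wpM2r ?ltW//.
  by rewrite mulrC -ltr_pdivlMr.
rewrite zsE [leLHS]dotv_sqrD (dotvDr (h *: w) r a) dotvZr.
have ar := dotv_le_enorm a r.
have ar2 : enorm a * enorm r <= enorm a * (e' * h).
  by rewrite ler_wpM2l// enorm_ge0.
have ar3 : (e' * (2 * enorm a + 1)) * h <= e / 2 * h by rewrite ler_wpM2r// ltW.
have : 0 <= e' * h by rewrite mulr_ge0// ltW.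
lra.
Qed.

(** Squared distances are truncated at r before being differentiated: the
    truncation is Lipschitz in the distance, so that it is absolutely continuous
    along a curve that is not known to be bounded. *)
Lemma min_sq_lip (a b r : R) : 0 <= a -> 0 <= b -> 0 <= r ->
  `|Num.min a r ^+ 2 - Num.min b r ^+ 2| <= (r *+ 2) * `|a - b|.
Proof.
move=> a0 b0 r0; rewrite subr_sqr normrM mulrC.
apply: ler_pM => //.
  have ma : 0 <= Num.min a r by rewrite le_min a0.
  have mb : 0 <= Num.min b r by rewrite le_min b0.
  rewrite ger0_norm ?addr_ge0//.
  by rewrite mulr2n lerD// ge_min lexx orbT.
have [ar|ra] := leP a r; have [br|rb] := leP b r => //.
- rewrite !ler0_norm; lra.
- rewrite !ger0_norm; lra.
- by rewrite subrr normr0.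
Qed.

Lemma min_sq_increment (a b r g : R) : 0 <= a -> 0 <= b -> 0 <= r -> 0 <= g ->
  b ^+ 2 <= a ^+ 2 + g -> Num.min b r ^+ 2 - Num.min a r ^+ 2 <= g.
Proof.
move=> a0 b0 r0 g0 bag.
have mb : 0 <= Num.min b r by rewrite le_min b0.
have mbb : Num.min b r ^+ 2 <= b ^+ 2 by rewrite lerXn2r ?nnegrE// ge_min lexx.
have mbr : Num.min b r ^+ 2 <= r ^+ 2.
  by rewrite lerXn2r ?nnegrE// ge_min lexx orbT.
by have [ra|ar] := leP a r; lra.
Qed.

Lemma truncated_sqdist_ac z p (r T : R) : 0 <= r -> abs_continuous 0 T z ->
  ac_on 0 T (fun t => Num.min (enorm (z t - p)) r ^+ 2).
Proof.
move=> r0 /abs_continuousP acz;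
  apply: (ac_increments_control (A := r *+ 2) (B := 0) _ _ acz).
- exact: mulrn_wge0.
- exact: lexx.
- move=> s t _ _ _; split; first exact: enorm_ge0.
  rewrite mul0r addr0; apply: (le_trans (min_sq_lip _ _ r0));
    rewrite ?enorm_ge0//.
  rewrite ler_wpM2l ?mulrn_wge0// ler_norml; apply/andP; split.
    by have := enorm_dist (z s) (z t) p; rewrite (enormB (z s) (z t)); lra.
  by have := enorm_dist (z t) (z s) p; lra.
Qed.

(** The truncation level r exceeds the initial distance, hence is never
    reached. *)
Lemma ae_dissipative_sqdist z p (T : R) : 0 <= T -> abs_continuous 0 T z ->
  {ae lambda, forall t : R, (0 <= t)%R -> (t < T)%R -> exists w,
     is_derive t (1 : R) z w /\ (dotv (z t - p) w <= 0)%R} ->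
  enorm (z T - p) <= enorm (z 0 - p).
Proof.
move=> T0 acz dis.
pose r := enorm (z 0 - p) + 1.
have r0 : 0 <= r by rewrite addr_ge0// enorm_ge0.
have := @ac_nonincreasing R 0 T _ T0 (truncated_sqdist_ac p r0 acz) _.
have minr : Num.min (enorm (z 0 - p)) r = enorm (z 0 - p).
  by apply/min_idPl; rewrite lerDl.
rewrite minr => H.
have : Num.min (enorm (z T - p)) r ^+ 2 <= enorm (z 0 - p) ^+ 2.
  apply: H; apply: (@filterS _ _ (ae_filter_ringOfSetsType lambda) _ _ _ dis).
  move=> t h t0 tT e e0; have [w [dz wle]] := h t0 tT.
  have [d d0 dd] := sqdist_dini p e0 dz; exists d => // s ts sd.
  apply: min_sq_increment; rewrite ?enorm_ge0//.
    by rewrite mulr_ge0 ?(ltW e0)// subr_ge0 ltW.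
  have hs := dd s ts sd.
  have h2 : dotv (z t - p) w * (s - t) <= 0.
    by rewrite mulr_le0_ge0// subr_ge0 ltW.
  rewrite !enorm_sqr; lra.
rewrite ler_pXn2r ?nnegrE ?enorm_ge0 ?le_min ?r0 ?enorm_ge0//.
rewrite ge_min => /orP[//|]; rewrite /r; lra.
Qed.

(** Let p be the projection of z t on S.  The squared distance of z s to S is at
    most |z s - p|^2, with equality at s = t, so its right Dini derivative is at
    most 2 <z t - p, w>.  For w = y - z t with y in S this is nonpositive by the
    variational inequality of the projection, and so it is for tangent w. *)
Lemma ae_viable z (S : set 'cV[R]_m) (T : R) : 0 <= T ->
  S !=set0 -> closed S -> segment_closed S ->
  abs_continuous 0 T z -> S (z 0) ->
  {ae lambda, forall t : R, (0 <= t)%R -> (t < T)%R -> exists w,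
     is_derive t (1 : R) z w /\ tangent_cone S (z t) w} ->
  S (z T).
Proof.
move=> T0 S0 cS sS /abs_continuousP acz Sz0 dz.
have [dist distE] : exists dist : R -> R,
    forall t, dist t = enorm (z t - eproj S (z t)).
  by eexists => t; reflexivity.
have Sp t : S (eproj S (z t)) by have [] := eprojP (z t) S0 cS.
have dist_le t q : S q -> dist t <= enorm (z t - q).
  by move=> Sq; rewrite distE; have [_] := eprojP (z t) S0 cS; apply.
have dist0 t : 0 <= dist t by rewrite distE enorm_ge0.
have dlip s t : dist t <= dist s + enorm (z t - z s).
  by apply: le_trans (dist_le t _ (Sp s)) _;
    rewrite [dist s + _]addrC distE enorm_dist.
have acd : ac_on 0 T (fun t => Num.min (dist t) 1 ^+ 2).
  apply: (ac_increments_control (A := 1 *+ 2) (B := 0) _ _ acz) => //.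
  move=> s t _ _ _; split; first exact: enorm_ge0.
  rewrite mul0r addr0; apply: (le_trans (min_sq_lip _ _ ler01)) => //.
  rewrite ler_wpM2l ?mulrn_wge0// ler_norml; apply/andP; split.
    by rewrite lerNl opprB lerBlDl enormB; exact: dlip.
  by rewrite lerBlDl; exact: dlip.
have d00 : dist 0 = 0.
  apply/eqP; rewrite eq_le dist0 andbT.
  by have := dist_le 0 _ Sz0; rewrite subrr enorm0.
have : Num.min (dist T) 1 ^+ 2 <= Num.min (dist 0) 1 ^+ 2.
  apply: (ac_nonincreasing T0 acd).
  apply: (@filterS _ _ (ae_filter_ringOfSetsType lambda) _ _ _ dz).
  move=> t h t0 tT e e0; have [w [dw Tw]] := h t0 tT.
  set p := eproj S (z t).
  have wle : dotv (z t - p) w <= 0.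
    apply/ler_addgt0Pr => e1 e10; rewrite add0r.
    have N0 : 0 < enorm (z t - p) + 1 by rewrite ltr_wpDl ?enorm_ge0.
    have /closure_enorm/(_ _ (divr_gt0 e10 N0))[_ [c c0 [y Sy ->]] wc] := Tw.
    have -> : dotv (z t - p) w = c^-1 * dotv (z t - p) (y - z t) +
       dotv (z t - p) (w - c^-1 *: (y - z t)).
      by rewrite -dotvZr -dotvDr [_ + (w - _)]addrC subrK.
    have : dotv (z t - p) (y - z t) <= 0.
      have -> : y - z t = (y - p) - (z t - p) by rewrite opprB addrA subrK.
      rewrite dotvDr dotvNr; have := eproj_vi (z t) S0 cS sS Sy.
      by have := dotv_ge0 (z t - p); rewrite -/p; lra.
    move=> h1; have : c^-1 * dotv (z t - p) (y - z t) <= 0.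
      by rewrite pmulr_rle0// invr_gt0.
    have h2 := dotv_le_enorm (z t - p) (w - c^-1 *: (y - z t)).
    have : enorm (z t - p) * enorm (w - c^-1 *: (y - z t)) <= e1.
      rewrite (enormB w); rewrite ltr_pdivlMr// in wc; apply: le_trans (ltW wc).
      by rewrite mulrC ler_wpM2l ?enorm_ge0// lerDl.
    lra.
  have [d d0 dd] := sqdist_dini p e0 dw; exists d => // s ts sd.
  apply: min_sq_increment => //.
    by rewrite mulr_ge0 ?(ltW e0)// subr_ge0 ltW.
  have h1 : dist s ^+ 2 <= dotv (z s - p) (z s - p).
    by rewrite -enorm_sqr lerXn2r ?nnegrE ?enorm_ge0//; exact: dist_le (Sp t).
  apply: (le_trans (le_trans h1 (dd s ts sd))).
  rewrite distE enorm_sqr -/p lerD2l mulrDl gerDr -mulrA pmulr_rle0//.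
  by rewrite mulr_le0_ge0// subr_ge0 ltW.
have m0 : Num.min 0 1 = 0 :> R by apply/min_idPl.
rewrite d00 m0 expr0n /= => h.
have : Num.min (dist T) 1 = 0.
  by apply/eqP; rewrite -sqrf_eq0 eq_le h sqr_ge0.
rewrite minEle; case: ifP => _ dT; last by move/eqP: dT; rewrite oner_eq0.
have := dT; rewrite distE => /enorm_eq0/eqP; rewrite subr_eq0 => /eqP ->;
  exact: Sp.
Qed.

(** exp (- c t) phi t is nonincreasing.  Both its Dini derivative and its
    absolute continuity follow from 1 + u <= exp u alone. *)
Lemma gronwall_zero (phi : R -> R) (T c Phi : R) : 0 <= T -> 0 <= c ->
  ac_on 0 T phi -> (forall t, 0 <= t -> t <= T -> 0 <= phi t /\ phi t <= Phi) ->
  phi 0 = 0 ->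
  {ae lambda, forall t : R, (0 <= t)%R -> (t < T)%R ->
     forall e : R, (0 < e)%R -> exists2 d : R, (0 < d)%R &
       forall s, (t < s)%R -> (s < t + d)%R ->
         (phi s - phi t <= (c * phi t + e) * (s - t))%R} ->
  phi T = 0.
Proof.
move=> T0 c0 acphi phib phi0 dini.
have Phi0 : 0 <= Phi by have [h1 h2] := phib 0 (lexx _) T0; exact: le_trans h2.
pose E t := expR (- (c * t)).
have E0 t : 0 < E t by exact: expR_gt0.
have Emono s t : s <= t -> E t <= E s.
  by move=> st; rewrite ler_expR lerN2 ler_wpM2l.
have E1 t : 0 <= t -> E t <= 1.
  by move=> /Emono /le_trans; apply; rewrite /E mulr0 oppr0 expR0.
have Elip s t : 0 <= s -> s <= t -> E s - E t <= c * (t - s).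
  move=> s0 st.
  have -> : E t = E s * expR (- (c * (t - s))).
    by rewrite /E -expRD; congr expR; ring.
  have := expR_ge1Dx (- (c * (t - s))); set x := expR _ => h.
  have := E1 _ s0; have := E0 s => h1 h2.
  have cts : 0 <= c * (t - s) by rewrite mulr_ge0 ?subr_ge0.
  have h3 : E s * (1 - x) <= E s * (c * (t - s))
    by rewrite ler_wpM2l ?(ltW h1)//; lra.
  have h4 : E s * (c * (t - s)) <= 1 * (c * (t - s)) by rewrite ler_wpM2r.
  lra.
have acpsi : ac_on 0 T (fun t => E t * phi t).
  apply: (ac_increments_control (A := 1) (B := Phi * c) _ _ acphi) => //.
    by rewrite mulr_ge0.
  move=> s t s0 st tT; split=> //.
  have -> : E t * phi t - E s * phi s =
    E t * (phi t - phi s) - (E s - E t) * phi s.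
    by ring.
  apply: (le_trans (ler_normB _ _)); rewrite !normrM gtr0_norm//.
  have ps := phib s s0 (le_trans st tT).
  have Est : 0 <= E s - E t by rewrite subr_ge0 Emono.
  rewrite (ger0_norm ps.1) (ger0_norm Est).
  apply: lerD.
    by apply: ler_wpM2r => //; apply: E1; exact: le_trans st.
  rewrite mulrC -mulrA; apply: ler_pM; rewrite ?subr_ge0 ?Emono//.
  - exact: ps.1.
  - exact: ps.2.
  - exact: Elip.
have : E T * phi T <= E 0 * phi 0.
  apply: (ac_nonincreasing T0 acpsi).
  apply: (@filterS _ _ (ae_filter_ringOfSetsType lambda) _ _ _ dini).
  move=> t h t0 tT e e0; have [d d0 dd] := h t0 tT e e0; exists d => // s ts sd.
  have [pt0 _] := phib t t0 (ltW tT).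
  have Et : E t = E s * expR (c * (s - t)).
    by rewrite /E -expRD; congr expR; ring.
  have h1 := expR_ge1Dx (c * (s - t)).
  have st0 : 0 < s - t by rewrite subr_gt0.
  have h2 : E s * phi t * (1 + c * (s - t)) <= E s * phi t * expR (c * (s - t)).
    by rewrite ler_wpM2l// mulr_ge0// ltW.
  have h3 := ler_wpM2l (ltW (E0 s)) (dd s ts sd).
  have h4 : E s * (e * (s - t)) <= 1 * (e * (s - t)).
    apply: ler_wpM2r; first by rewrite mulr_ge0// ltW.
    by apply: E1; apply: le_trans (ltW ts).
  rewrite Et; lra.
rewrite phi0 mulr0 pmulr_rle0// => h; apply/eqP.
by rewrite eq_le h; have [] := phib T T0 (lexx _).
Qed.

End dini_consequences.

(** * Dissipative projected dynamics *)

Lemma max0_lip {R : realType} (s t : R) :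
  `|Num.max 0 t - Num.max 0 s| <= `|t - s|.
Proof.
have [t0|t0] := leP 0 t; have [s0|s0] := leP 0 s => //.
- by rewrite subr0 (ger0_norm t0) ger0_norm ?subr_ge0; lra.
- by rewrite sub0r normrN (ger0_norm s0) ler0_norm; lra.
- by rewrite subrr normr0.
Qed.

Section projected_dynamics.
Context {R : realType} {m : nat}.
Notation lambda := (@lebesgue_measure R).
Variables (C : set 'cV[R]_m) (f : 'cV[R]_m -> 'cV[R]_m) (zbar z0 : 'cV[R]_m).
Variable (W : 'cV[R]_m -> R).
Hypotheses (Cclosed : closed C) (Ccvx : segment_closed C).
Hypotheses (Czbar : C zbar) (Cz0 : C z0).
Hypothesis f_loc_lip : forall r : R, exists2 L : R, 0 <= L & forall x y,
  enorm (x - zbar) <= r -> enorm (y - zbar) <= r ->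
  enorm (f x - f y) <= L * enorm (x - y).
Hypothesis W_ge0 : forall z, C z -> 0 <= W z.
Hypothesis f_dissipative : forall z, C z -> dotv (f z) (z - zbar) <= - W z.

(** The projected equation z' = P(f z), with P the projection on the tangent
    cone of C at z, without its tangency condition, which the derivative of a
    curve in C satisfies automatically. *)
Definition solves_vi (z : R -> 'cV[R]_m) (t : R) (w : 'cV[R]_m) :=
  is_derive t (1 : R) z w /\
  forall y, C y -> dotv (f (z t) - w) (y - z t) <= 0.

Let r := enorm (z0 - zbar) + 1.
Let C' := C `&` [set z | enorm (z - zbar) <= r].

Let r0 : 0 <= r. Proof. by rewrite addr_ge0// enorm_ge0. Qed.

Let C'closed : closed C'.
Proof.
apply: closedI => //; apply/closed_enorm => u h /=.
apply/ler_addgt0Pr => e e0; have [w /= wr we] := h e e0.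
apply: (le_trans (enorm_dist u w zbar)); rewrite addrC; apply: lerD => //.
by rewrite enormB ltW.
Qed.

Let C'cvx : segment_closed C'.
Proof.
move=> x y t t0 t1 [Cx /= xr] [Cy /= yr]; split; [exact: Ccvx|rewrite /=].
have -> : x + t *: (y - x) - zbar = (1 - t) *: (x - zbar) + t *: (y - zbar).
  by apply/matrixP => i j; rewrite !mxE; ring.
apply: (le_trans (enormD _ _)); rewrite !enormZ !ger0_norm ?subr_ge0//.
have h1 : (1 - t) * enorm (x - zbar) <= (1 - t) * r
  by rewrite ler_wpM2l ?subr_ge0.
have h2 : t * enorm (y - zbar) <= t * r by rewrite ler_wpM2l.
by apply: le_trans (lerD h1 h2) _; rewrite -mulrDl subrK mul1r.
Qed.

Let C'z0 : C' z0. Proof. by split=> //=; rewrite lerDl. Qed.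
Let C'zbar : C' zbar. Proof. by split=> //=; rewrite subrr enorm0. Qed.

Lemma ae_neq0 : {ae lambda, forall t : R, t != 0}.
Proof.
exists [set 0]; split => //; first exact: lebesgue_measure_set1.
by move=> t /= /negP; rewrite negbK => /eqP.
Qed.

(** Run the scheme in C' = C /\ B, where the radius of the ball B exceeds the
    initial distance to zbar by 1.  Dissipation keeps the solution at distance
    at least 1 from the boundary of B, so that the variational inequality on
    C' extends to C. For the last claim, if W (z s) >= e then |z - zbar|^2
    drops by tau e during the time tau = e / (K + 1), which is impossible once
    it is within tau e of its infimum. *)
Lemma projected_dynamics_solution : exists z : R -> 'cV[R]_m,
  [/\ z 0 = z0, (forall t, 0 <= t -> C (z t)),
    (exists K : R, forall s t : R, 0 <= s -> 0 <= t ->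
       enorm (z t - z s) <= K * `|t - s|),
    {ae lambda, forall t : R, (0 <= t)%R -> exists w,
       [/\ (0 < t)%R, solves_vi z t w & dotv (f (z t) - w) w = 0%R]} &
    (forall t, 0 <= t -> enorm (z t - zbar) <= enorm (z0 - zbar)) /\
    forall e : R, 0 < e -> exists T : R, 0 <= T /\ forall t, T <= t ->
      W (z t) < e].
Proof.
have [L L0 fL] := f_loc_lip r.
have CD x y : C' x -> C' y -> enorm (x - y) <= r + r.
  move=> [_ /= xr] [_ /= yr]; apply: (le_trans (enorm_dist x zbar y)).
  by apply: lerD => //; rewrite enormB.
have fL' x y : C' x -> C' y -> enorm (f x - f y) <= L * enorm (x - y).
  by move=> [_ xr] [_ yr]; exact: fL.
have fB x : C' x -> enorm (f x) <= L * r + enorm (f zbar).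
  move=> C'x; have := enorm_dist (f x) (f zbar) 0; rewrite !subr0 => /le_trans.
  apply; rewrite lerD2r; apply: (le_trans (fL' _ _ C'x C'zbar)).
  by rewrite ler_wpM2l//; case: C'x.
have [z [K [K0 zz0 zC' evi]]] := evi_existence C'closed C'cvx C'z0 CD fL' fB L0.
have zC t : C (z t) by case: (zC' t).
pose V t := dotv (z t - zbar) (z t - zbar).
have Vdecay s t : 0 <= s -> s <= t ->
    V t <= V s - 2 * (t - s) * W (z s) + K * (t - s) ^+ 2.
  move=> s0 st; apply: (le_trans (evi s t zbar s0 st C'zbar)).
  rewrite lerD2r lerD2l -mulrN ler_wpM2l ?f_dissipative//.
  by rewrite mulr_ge0// subr_ge0.
have Vmono s t : 0 <= s -> s <= t -> V t <= V s.
  apply: (quadratic_slack_nonincreasing K0) => {}s {}t s0 st.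
  apply: (le_trans (Vdecay s t s0 st)); rewrite lerD2r gerDl oppr_le0.
  by rewrite mulr_ge0 ?W_ge0// mulr_ge0// subr_ge0.
have zin t : 0 <= t -> enorm (z t - zbar) <= enorm (z0 - zbar).
  by move=> t0; rewrite le_enorm_sqr -zz0; exact: Vmono.
have zlip := evi_lipschitz K0 zC' evi.
exists z; split => //.
- by exists (Num.sqrt K + 1).
- have K1 : 0 < Num.sqrt K + 1 by rewrite ltr_wpDl ?sqrtr_ge0.
  have ylip (s t : R) : enorm (z (Num.max 0 t) - z (Num.max 0 s)) <=
      (Num.sqrt K + 1) * `|t - s|.
    apply: (le_trans (zlip _ _ _ _)); rewrite ?le_max ?lexx//.
    by rewrite ler_wpM2l ?(ltW K1)//; exact: max0_lip.
  have dy := lipschitz_curve_ae_derivable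
    (z := fun t => z (Num.max 0 t)) K1 ylip.
  apply: (@filterS2 _ _ (ae_filter_ringOfSetsType lambda) _ _ _ _ ae_neq0 dy).
  move=> t tn0 [w dw] t0; exists w.
  have tp : 0 < t by rewrite lt_def tn0.
  have dz : is_derive t (1 : R) z w.
    apply/is_derive_enorm => e e0;
      have [d d0 dd] := (is_derive_enorm _ _ _).1 dw e e0.
    exists (Num.min d t); first by rewrite lt_min d0.
    move=> s; rewrite lt_min => /andP[sd st].
    have s0 : 0 <= s by move: st; rewrite ltr_norml => /andP[st _]; lra.
    by have := dd s sd; rewrite (max_r s0) (max_r t0).
  have vi' y : C' y -> dotv (f (z t) - w) (y - z t) <= 0.
    by exact: (evi_velocity K0 evi t0 dz).
  have vi y : C y -> dotv (f (z t) - w) (y - z t) <= 0.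
    (* The point at fraction c of the segment from z t to y is still in C'. *)
    move=> Cy; pose c := (1 + enorm (y - z t))^-1.
    have c1 : 0 < 1 + enorm (y - z t) by rewrite ltr_pwDl ?enorm_ge0.
    have c0 : 0 < c by rewrite invr_gt0.
    have := vi' (z t + c *: (y - z t)).
    rewrite addrAC subrr add0r dotvZr pmulr_rle0//; apply.
    split=> /=.
      apply: Ccvx => //; first exact: ltW.
      by rewrite invf_le1// lerDl enorm_ge0.
    rewrite addrAC; apply: (le_trans (enormD _ _)); apply: lerD;
      first exact: zin.
    rewrite enormZ gtr0_norm// /c mulrC ler_pdivrMr// mul1r lerDr.
    by [].
  split => //; apply: (velocity_orthogonal zC tp dz) => y; exact: vi.
- split=> // e e0.
  have K1 : 0 < K + 1 by rewrite ltr_wpDl.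
  pose tau := e / (K + 1); have tau0 : 0 < tau by rewrite divr_gt0.
  have tauE : tau * (K + 1) = e by rewrite /tau divfK// gt_eqF.
  pose S := [set V t | t in [set t | 0 <= t]].
  have infS : has_inf S.
    split; first by exists (V 0), 0 => //=.
    by exists 0 => _ [t _ <-]; exact: dotv_ge0.
  have te0 : 0 < tau * e by rewrite mulr_gt0.
  have [_ [T /= T0 <-] VT] := inf_adherent te0 infS.
  exists T; split=> // s Ts; rewrite ltNge; apply/negP => We.
  have s0 : 0 <= s := le_trans T0 Ts.
  have st : s <= s + tau by rewrite lerDl ltW.
  have := Vdecay s (s + tau) s0 st; rewrite (addrAC s) subrr add0r => h1.
  have h2 := Vmono T s T0 Ts.
  have h3 : inf S <= V (s + tau).
    by apply: inf_lbound; [exact: infS.2|exists (s + tau) => //=;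
      rewrite addr_ge0// ltW].
  have h4 : tau * e <= tau * W (z s) by rewrite ler_pM2l.
  have h5 : tau ^+ 2 * (K + 1) = tau * e by rewrite expr2 -mulrA tauE.
  have h6 : 0 <= tau ^+ 2 by exact: sqr_ge0.
  lra.
Qed.

(** Dissipation keeps z2 in the ball where f is Lipschitz.  Testing each
    variational inequality with the other solution gives
    <z1 - z2, z1' - z2'> <= <z1 - z2, f z1 - f z2>, and Gronwall applies to
    |z1 - z2|^2. *)
Lemma projected_dynamics_unique (z1 z2 : R -> 'cV[R]_m) (K T : R) : 0 <= T ->
  z1 0 = z2 0 ->
  (forall t, 0 <= t -> C (z1 t)) -> (forall t, 0 <= t -> C (z2 t)) ->
  (forall t, 0 <= t -> enorm (z1 t - zbar) <= enorm (z0 - zbar)) ->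
  z2 0 = z0 ->
  (forall s t : R, 0 <= s -> 0 <= t -> enorm (z1 t - z1 s) <= K * `|t - s|) ->
  (forall T : R, 0 <= T -> abs_continuous 0 T z2) ->
  {ae lambda, forall t : R, (0 <= t)%R -> exists w, solves_vi z1 t w} ->
  {ae lambda, forall t : R, (0 <= t)%R -> exists w, solves_vi z2 t w} ->
  z1 T = z2 T.
Proof.
move=> T0 z12 z1C z2C z1b z20 z1lip z2ac d1 d2.
have [L L0 fL] := f_loc_lip r.
have z2b t : 0 <= t -> enorm (z2 t - zbar) <= enorm (z0 - zbar).
  move=> t0; rewrite -z20; apply: ae_dissipative_sqdist => //;
    first exact: z2ac.
  apply: (@filterS _ _ (ae_filter_ringOfSetsType lambda) _ _ _ d2) =>
    s ds s0 st.
  have [w [dw vi]] := ds s0; exists w; split=> //.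
  have := vi zbar Czbar; have := f_dissipative (z2C s s0);
    have := W_ge0 (z2C s s0).
  rewrite -(opprB (z2 s) zbar) dotvNr dotvDl dotvNl (dotvC (z2 s - zbar) w);
    lra.
have rr : enorm (z0 - zbar) <= r by rewrite lerDl.
have K0 : 0 <= K.
  by have := z1lip 0 1 (lexx _) ler01; rewrite subr0 normr1 mulr1;
    apply: le_trans; exact: enorm_ge0.
pose d t := z1 t - z2 t.
have db t : 0 <= t -> enorm (d t) <= r + r.
  move=> t0; apply: (le_trans (enorm_dist _ zbar _)); apply: lerD.
    exact: le_trans (z1b t t0) rr.
  by rewrite enormB; exact: le_trans (z2b t t0) rr.
have rr0 : 0 <= r + r by rewrite addr_ge0.
suff : dotv (d T) (d T) = 0.
  by move=> /dotv_eq0/eqP; rewrite subr_eq0 => /eqP.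
apply: (@gronwall_zero _
  (fun t => dotv (d t) (d t)) T (2 * L) ((r + r) ^+ 2)) => //.
- by rewrite mulr_ge0.
- have /abs_continuousP ac2 := z2ac T T0.
  apply: (ac_increments_control (A := (r + r) *+ 2)
    (B := (r + r) *+ 2 * K) _ _ ac2).
  + by rewrite mulrn_wge0.
  + by rewrite mulr_ge0// mulrn_wge0.
  + move=> s t s0 st tT; split; first exact: enorm_ge0.
    have t0 : 0 <= t := le_trans s0 st.
    rewrite dotv_subr_sqr; apply: (le_trans (dotv_abs_le _ _)).
    have h1 : enorm (d t + d s) <= (r + r) *+ 2.
      by apply: (le_trans (enormD _ _)); rewrite mulr2n lerD// db.
    have h2 : enorm (d t - d s) <= enorm (z2 t - z2 s) + K * (t - s).
      have -> : d t - d s = (z1 t - z1 s) + (z2 s - z2 t).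
        by apply/matrixP => i j; rewrite !mxE; ring.
      apply: (le_trans (enormD _ _)); rewrite addrC; apply: lerD.
        by rewrite enormB.
      by have := z1lip s t s0 t0; rewrite ger0_norm// subr_ge0.
    rewrite -mulrA -mulrDr mulrC.
    by apply: ler_pM => //; exact: enorm_ge0.
- move=> t t0 tT; split; first exact: dotv_ge0.
  by rewrite -enorm_sqr lerXn2r ?nnegrE ?enorm_ge0// db.
- by rewrite /d z12 subrr dotv0l.
- apply: (@filterS2 _ _ (ae_filter_ringOfSetsType lambda) _ _ _ _ d1 d2).
  move=> t dt1 dt2 t0 tT e e0.
  have [w1 [dw1 vi1]] := dt1 t0; have [w2 [dw2 vi2]] := dt2 t0.
  have dd : is_derive t (1 : R) d (w1 - w2) by exact: is_deriveB.
  have [del del0 h] := sqdist_dini 0 e0 dd; exists del => // s ts sd.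
  have := h s ts sd; rewrite !subr0 => hs.
  have vi1' := vi1 _ (z2C t t0); have vi2' := vi2 _ (z1C t t0).
  have fd : dotv (f (z1 t) - f (z2 t)) (d t) <= L * dotv (d t) (d t).
    apply: (le_trans (dotv_le_enorm _ _)); rewrite -enorm_sqr expr2 mulrA.
    rewrite ler_wpM2r ?enorm_ge0//; apply: fL.
      exact: le_trans (z1b t t0) rr.
    exact: le_trans (z2b t t0) rr.
  have wd : dotv (d t) (w1 - w2) <= L * dotv (d t) (d t).
    apply: le_trans fd; rewrite dotvC.
    move: vi1' vi2'; rewrite -/(d t) -(opprB (z1 t) (z2 t)) -/(d t) dotvNr.
    by rewrite !dotvDl !dotvNl; lra.
  have st0 : 0 <= s - t by rewrite subr_ge0 ltW.
  have := ler_wpM2r st0 wd; move: hs; lra.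
Qed.

End projected_dynamics.

(** * Block vectors and Kronecker products *)

Section blocks.
Context {R : realType}.

Lemma dotv_mulmxl m p (A : 'M[R]_(m, p)) u v :
  dotv (A *m u) v = dotv u (A^T *m v).
Proof. by rewrite /dotv trmx_mul mulmxA. Qed.

Lemma mulmx_enorm_bound m p (A : 'M[R]_(m, p)) :
  exists2 c : R, 0 <= c & forall v : 'cV[R]_p, enorm (A *m v) <= c * enorm v.
Proof.
exists (\sum_i enorm (row i A)^T); first
  by apply: sumr_ge0 => i _; exact: enorm_ge0.
move=> v; set u := A *m v.
have ub i : `|u i 0| <= enorm (row i A)^T * enorm v.
  have -> : u i 0 = dotv (row i A)^T v.
    by rewrite /dotv trmxK /u !mxE; apply: eq_bigr => j _; rewrite mxE.
  exact: dotv_abs_le.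
apply: (le_trans (enorm_le_sum u)); rewrite mulr_suml.
exact: ler_sum.
Qed.

Lemma dotv_blocks p (p_ : 'I_p -> nat) (u v : 'cV[R]_(\sum_i p_ i)) :
  dotv u v = \sum_i dotv (submxcol u i) (submxcol v i).
Proof.
rewrite /dotv -[u in LHS]submxcolK -[v in LHS]submxcolK tr_mxcol
  mul_mxrow_mxcol.
by rewrite summxE.
Qed.

Lemma submxcolZ p (p_ : 'I_p -> nat) (c : R) (u : 'cV[R]_(\sum_i p_ i)) i :
  submxcol (c *: u) i = c *: submxcol u i.
Proof. by apply/matrixP => k l; rewrite !mxE. Qed.

Lemma enorm_block_le p (p_ : 'I_p -> nat) (u : 'cV[R]_(\sum_i p_ i)) i :
  enorm (submxcol u i) <= enorm u.
Proof.
rewrite le_enorm_sqr (dotv_blocks u) (bigD1 i)//= lerDl sumr_ge0// => j _.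
exact: dotv_ge0.
Qed.

Lemma kron_block p q m (A : 'M[R]_(p, q)) (x : 'cV[R]_(\sum_(j < q) m)) i :
  submxcol (kron A (1%:M : 'M[R]_m) *m x) i = \sum_j A i j *: submxcol x j.
Proof.
rewrite -[x in LHS]submxcolK /kron mul_mxblock_mxrow mxcolK.
by apply: eq_bigr => j _; rewrite -scalemxAl mul1mx.
Qed.

Lemma kron_mul p q r m (A : 'M[R]_(p, q)) (B : 'M[R]_(q, r)) :
  kron A (1%:M : 'M[R]_m) *m kron B (1%:M : 'M[R]_m) = kron (A *m B) 1%:M.
Proof.
rewrite /kron mul_mxblock; apply: eq_mxblock => i k.
rewrite mxE scaler_suml; apply: eq_bigr => j _.
by rewrite -scalemxAl -scalemxAr mul1mx scalerA.
Qed.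

Lemma kron_tr p q m (A : 'M[R]_(p, q)) :
  (kron A (1%:M : 'M[R]_m))^T = kron A^T 1%:M.
Proof.
rewrite /kron tr_mxblock; apply: eq_mxblock => i j.
by rewrite linearZ /= trmx1 mxE.
Qed.

Context {N : nat} {n : 'I_N -> nat}.
Local Notation M := (\sum_(i < N) n i)%N.
Local Notation NM := (\sum_(i < N) M)%N.

Lemma selmx_block (x : 'cV[R]_NM) i :
  submxcol (selmx R n *m x) i = submxcol (submxcol x i) i.
Proof.
rewrite -[x in LHS]submxcolK /selmx mul_mxblock_mxrow mxcolK (bigD1 i)//= eqxx.
rewrite [X in _ + X]big1 ?addr0; last
  by move=> j ji; rewrite eq_sym (negbTE ji) mul0mx.
by rewrite /selblock submxcol_mul mul1mx.
Qed.

Lemma enorm_selmx_le (x : 'cV[R]_NM) : enorm (selmx R n *m x) <= enorm x.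
Proof.
rewrite le_enorm_sqr (dotv_blocks (selmx R n *m x)) (dotv_blocks x).
apply: ler_sum => i _; rewrite selmx_block.
by rewrite -le_enorm_sqr enorm_block_le.
Qed.

Lemma selmx_trK (y : 'cV[R]_M) : selmx R n *m ((selmx R n)^T *m y) = y.
Proof.
rewrite -[RHS]submxcolK -[LHS]submxcolK; apply: eq_mxcol => i.
rewrite selmx_block /selmx tr_mxblock -[y in LHS]submxcolK.
rewrite mul_mxblock_mxrow mxcolK (bigD1 i)//= eqxx [X in _ + X]big1 ?addr0;
  last first.
  by move=> j ji; rewrite (negbTE ji) trmx0 mul0mx.
rewrite -submxcol_mul -[RHS]mul1mx; congr (_ *m _).
apply/matrixP => k l; rewrite !mxE -val_eqE /= tagnat.eq_Rank eqxx.
by rewrite val_eqE eq_sym.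
Qed.

Lemma selmx_mxcol (y : 'cV[R]_M) : selmx R n *m (\mxcol_(i < N) y) = y.
Proof. by apply/mxcolP => i; rewrite selmx_block mxcolK. Qed.

End blocks.

(** * Bounded Lipschitz functions and linear images of curves *)

Section bounded_lipschitz.
Context {R : realType} {m : nat}.
Variable (P : set 'cV[R]_m) (rad : R).
Hypothesis P_bounded : forall z, P z -> enorm z <= rad.
Hypothesis rad0 : 0 <= rad.
Implicit Types h g : 'cV[R]_m -> R.

(** On a bounded set these functions form a ring containing the coordinates:
    this covers the coordinates of the polynomial part of the dynamics. *)
Definition bounded_lip h := exists B L : R, [/\ 0 <= B, 0 <= L,
  (forall z, P z -> `|h z| <= B) &
  (forall z y, P z -> P y -> `|h z - h y| <= L * enorm (z - y))].

Lemma bounded_lip_cst c : bounded_lip (fun=> c).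
Proof.
exists `|c|, 0; split=> // z y _ _; by rewrite subrr normr0 mul0r.
Qed.

Lemma bounded_lip_coord i : bounded_lip (fun z => z i 0).
Proof.
exists rad, 1; split=> // [z Pz|z y _ _].
  exact: le_trans (coord_le_enorm z i) (P_bounded Pz).
by rewrite mul1r; apply: le_trans (coord_le_enorm _ i); rewrite !mxE.
Qed.

Lemma bounded_lip_add h g : bounded_lip h -> bounded_lip g ->
  bounded_lip (fun z => h z + g z).
Proof.
move=> [B1 [L1 [B10 L10 hB hL]]] [B2 [L2 [B20 L20 gB gL]]].
exists (B1 + B2), (L1 + L2); split;
  [exact: addr_ge0|exact: addr_ge0|move=> z Pz|move=> z y Pz Py].
  by apply: (le_trans (ler_normD _ _)); rewrite lerD ?hB ?gB.
have -> : h z + g z - (h y + g y) = (h z - h y) + (g z - g y) by ring.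
by apply: (le_trans (ler_normD _ _)); rewrite mulrDl lerD ?hL ?gL.
Qed.

Lemma bounded_lip_mul h g : bounded_lip h -> bounded_lip g ->
  bounded_lip (fun z => h z * g z).
Proof.
move=> [B1 [L1 [B10 L10 hB hL]]] [B2 [L2 [B20 L20 gB gL]]].
exists (B1 * B2), (L1 * B2 + B1 * L2).
split; rewrite ?mulr_ge0//; first by rewrite addr_ge0 ?mulr_ge0.
  by move=> z Pz; rewrite normrM ler_pM ?hB ?gB.
move=> z y Pz Py.
have -> : h z * g z - h y * g y = (h z - h y) * g z + h y * (g z - g y) by ring.
apply: (le_trans (ler_normD _ _)); rewrite !normrM mulrDl; apply: lerD.
  by rewrite mulrAC ler_pM ?hL ?gB.
by rewrite -mulrA ler_pM ?hB ?gL.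
Qed.

Lemma bounded_lip_sum (I : Type) (s : seq I) (h : I -> 'cV[R]_m -> R) :
  (forall i, bounded_lip (h i)) -> bounded_lip (fun z => \sum_(i <- s) h i z).
Proof.
move=> bh; elim: s => [|i s IH].
  rewrite (_ : (fun z => _) = fun=> 0); first exact: bounded_lip_cst.
  by apply/funext => z; rewrite big_nil.
rewrite (_ : (fun z => _) = fun z => h i z + \sum_(i <- s) h i z).
  exact: bounded_lip_add.
by apply/funext => z; rewrite big_cons.
Qed.

Lemma bounded_lip_of_lip h (L : R) : 0 <= L -> P !=set0 ->
  (forall z y, `|h z - h y| <= L * enorm (z - y)) -> bounded_lip h.
Proof.
move=> L0 [z0 Pz0] hL; exists (`|h z0| + L * (rad + rad)), L; split => //.
  by rewrite addr_ge0// mulr_ge0// addr_ge0.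
move=> z Pz; rewrite -[h z](subrK (h z0)) addrC.
apply: (le_trans (ler_normD _ _)); rewrite lerD2l; apply: (le_trans (hL _ _)).
rewrite ler_wpM2l//; apply: (le_trans (enormD _ _)); rewrite enormN.
by apply: lerD; exact: P_bounded.
Qed.

Lemma bounded_lip_vector p (F : 'cV[R]_m -> 'cV[R]_p) :
  (forall i, bounded_lip (fun z => F z i 0)) ->
  exists2 L : R, 0 <= L & forall z y, P z -> P y ->
    enorm (F z - F y) <= L * enorm (z - y).
Proof.
move=> /choice[B] /choice[L] FL.
exists (\sum_i L i); first by apply: sumr_ge0 => i _; case: (FL i).
move=> z y Pz Py; apply: (le_trans (enorm_le_sum _)); rewrite mulr_suml.
by apply: ler_sum => i _; rewrite !mxE; case: (FL i) => _ _ _; exact.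
Qed.

End bounded_lipschitz.

Section linear_curves.
Context {R : realType}.

Lemma is_derive_linear m p (g : {linear 'cV[R]_m -> 'cV[R]_p}) (c : R)
    (z : R -> 'cV[R]_m) (t : R) (w : 'cV[R]_m) : 0 <= c ->
  (forall v, enorm (g v) <= c * enorm v) ->
  is_derive t (1 : R) z w -> is_derive t (1 : R) (g \o z) (g w).
Proof.
move=> c0 gc /is_derive_enorm dz; apply/is_derive_enorm => e e0.
have c1 : 0 < c + 1 by rewrite ltr_wpDl.
have [d d0 dd] := dz _ (divr_gt0 e0 c1); exists d => // s sd.
rewrite /= -linearZ -!linearB; apply: (le_trans (gc _)).
apply: (@le_trans _ _ ((c + 1) * (e / (c + 1) * `|s - t|))).
  by apply: ler_pM; rewrite ?enorm_ge0 ?dd// lerDl.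
by rewrite mulrA [_ * (e / _)]mulrC divfK// gt_eqF.
Qed.

Lemma is_derive_mulmx m p (A : 'M[R]_(p, m)) (z : R -> 'cV[R]_m) (t : R) w :
  is_derive t (1 : R) z w -> is_derive t (1 : R) (fun s => A *m z s) (A *m w).
Proof.
have [c c0 cb] := mulmx_enorm_bound A => dz.
exact: (@is_derive_linear _ _ (mulmx A) c z t w).
Qed.

Lemma dotv_col_mx m p (u v : 'cV[R]_m) (u' v' : 'cV[R]_p) :
  dotv (col_mx u u') (col_mx v v') = dotv u v + dotv u' v'.
Proof. by rewrite /dotv tr_col_mx mul_row_col mxE. Qed.

Lemma enorm_usubmx m p (z : 'cV[R]_(m + p)) : enorm (usubmx z) <= enorm z.
Proof.
by rewrite le_enorm_sqr -[z in leRHS]vsubmxK dotv_col_mx lerDl dotv_ge0.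
Qed.

Lemma enorm_dsubmx m p (z : 'cV[R]_(m + p)) : enorm (dsubmx z) <= enorm z.
Proof.
by rewrite le_enorm_sqr -[z in leRHS]vsubmxK dotv_col_mx lerDr dotv_ge0.
Qed.

Lemma enorm_col_mx m p (u : 'cV[R]_m) (v : 'cV[R]_p) :
  enorm (col_mx u v) <= enorm u + enorm v.
Proof.
apply: enorm_le_sqr; first by rewrite addr_ge0// enorm_ge0.
rewrite dotv_col_mx -!enorm_sqr sqrrD.
have : 0 <= enorm u * enorm v by rewrite mulr_ge0// enorm_ge0.
lra.
Qed.

Lemma is_derive_col_mx m p (x : R -> 'cV[R]_m) (k : R -> 'cV[R]_p) (t : R) u v :
  is_derive t (1 : R) x u -> is_derive t (1 : R) k v ->
  is_derive t (1 : R) (fun s => col_mx (x s) (k s)) (col_mx u v).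
Proof.
move=> /is_derive_enorm dx /is_derive_enorm dk; apply/is_derive_enorm => e e0.
have e20 : 0 < e / 2 by rewrite divr_gt0.
have [d1 d10 h1] := dx _ e20; have [d2 d20 h2] := dk _ e20.
exists (Num.min d1 d2); first by rewrite lt_min d10.
move=> s; rewrite lt_min => /andP[/h1 + /h2].
rewrite scale_col_mx !opp_col_mx !add_col_mx => a1 a2.
apply: (le_trans (enorm_col_mx _ _)); lra.
Qed.

Lemma lipschitz_abs_continuous m (z : R -> 'cV[R]_m) (K T1 T2 : R) : 0 <= T1 ->
  (forall s t : R, 0 <= s -> 0 <= t -> enorm (z t - z s) <= K * `|t - s|) ->
  abs_continuous T1 T2 z.
Proof.
move=> T10 zK; apply/abs_continuousP.
have K0 : 0 <= K.
  by have := zK 0 1 (lexx _) ler01; rewrite subr0 normr1 mulr1;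
    apply: le_trans; exact: enorm_ge0.
apply: (ac_increments_control (A := K) (B := 0)
  K0 (lexx _) (@ac_increments_id _ T1 T2)).
move=> s t s0 st _; rewrite subr_ge0; split=> //; rewrite mul0r addr0.
have := zK s t (le_trans T10 s0) (le_trans T10 (le_trans s0 st)).
by rewrite ger0_norm// subr_ge0.
Qed.

End linear_curves.

(** * Laplacian of a connected graph *)

Section graph.
Context {R : realType} {N : nat}.
Variable a : 'M[R]_N.
Hypothesis a_und : undirected a.

Lemma laplacianE i j : laplacian a i j = (\sum_l a i l) *+ (i == j) - a i j.
Proof. by rewrite /laplacian !mxE. Qed.

Lemma laplacian_tr : (laplacian a)^T = laplacian a.
Proof.
apply/matrixP => i j; rewrite mxE !laplacianE eq_sym a_und.2.
by have [->|] := eqVneq i j.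
Qed.

Lemma laplacian_mul (v : 'cV[R]_N) i :
  (laplacian a *m v) i 0 = \sum_j a i j * (v i 0 - v j 0).
Proof.
rewrite mxE; under eq_bigr do rewrite laplacianE mulrBl.
rewrite sumrB (bigD1 i)//= eqxx mulr1n [\sum_(j | j != i) _]big1 ?addr0;
  last first.
  by move=> j ji; rewrite eq_sym (negbTE ji) mul0r.
by under [RHS]eq_bigr do rewrite mulrBr; rewrite sumrB -mulr_suml.
Qed.

Hypothesis a_con : graph_connected a.

(** <v, L v> is half the sum of the a_ij (v_i - v_j)^2, so that v takes equal
    values at adjacent vertices. *)
Lemma laplacian_kernel (v : 'cV[R]_N) : laplacian a *m v = 0 ->
  forall i j, v i 0 = v j 0.
Proof.
move=> Lv0.
pose S1 := \sum_i \sum_j a i j * (v i 0 - v j 0) * v i 0.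
have S10 : S1 = 0.
  apply: big1 => i _; rewrite -mulr_suml -laplacian_mul Lv0 mxE.
  by rewrite mul0r.
pose S2 := \sum_i \sum_j a i j * (v i 0 - v j 0) * v j 0.
have S1E : S1 = - S2.
  rewrite /S1 /S2 exchange_big/= -sumrN; apply: eq_bigr => i _.
  rewrite -sumrN; apply: eq_bigr => j _; rewrite a_und.2.
  by rewrite -mulNr -mulrN opprB.
have : \sum_i \sum_j a i j * (v i 0 - v j 0) ^+ 2 = 0.
  rewrite -[RHS](addr0 0) -[in RHS]S10 [in X in _ = _ + X]S1E /S1 /S2 -sumrB.
  apply: eq_bigr => i _; rewrite -sumrB; apply: eq_bigr => j _; ring.
move=> /eqP; rewrite psumr_eq0; last first.
  by move=> i _; apply: sumr_ge0 => j _; rewrite mulr_ge0 ?sqr_ge0// a_und.1.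
move=> /allP E0.
have edge i j : 0 < a i j -> v i 0 = v j 0.
  move=> aij; have := E0 i (mem_index_enum _); rewrite /= psumr_eq0; last first.
    by move=> l _; rewrite mulr_ge0 ?sqr_ge0// a_und.1.
  move=> /allP/(_ j (mem_index_enum _)); rewrite /= mulf_eq0 gt_eqF//=.
  by rewrite sqrf_eq0 subr_eq0 => /eqP.
(* Propagation along a path from i to j. *)
move=> i j; have /connectP[p] := a_con i j.
elim: p i => [|l p IH] i /=; first by move=> _ ->.
by move=> /andP[/edge -> pl] /IH; apply.
Qed.

Definition averaging : 'M[R]_N := const_mx N%:R^-1.

(** The kernel of L consists of constant vectors, which 1 - averaging kills. *)
Lemma averaging_factor :
  exists G : 'M[R]_N, 1%:M - averaging = G *m laplacian a.
Proof.
apply/submxP; rewrite submxE; apply/eqP/matrixP => i j.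
have Lc := mulmx_coker (laplacian a); set C := cokermx _ in Lc *.
clearbody C.
have colc l l' : C l j = C l' j.
  have := @laplacian_kernel (col j C) _ l l'.
  by rewrite {1}colE mulmxA Lc mul0mx !mxE; exact.
rewrite mulmxBl mul1mx !mxE.
under eq_bigr do rewrite mxE (colc _ i).
rewrite sumr_const card_ord -[X in _ - X]mulr_natl mulrA divff ?mul1r ?subrr//.
by rewrite pnatr_eq0 -lt0n (leq_ltn_trans _ (ltn_ord i)).
Qed.

Context {m : nat}.
Local Notation NM := (\sum_(i < N) m)%N.

Definition average (x : 'cV[R]_NM) : 'cV[R]_m := N%:R^-1 *: \sum_j submxcol x j.

Lemma averaging_block (x : 'cV[R]_NM) :
  kron averaging (1%:M : 'M[R]_m) *m x = \mxcol_(i < N) average x.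
Proof.
apply/mxcolP => i; rewrite kron_block mxcolK /average scaler_sumr.
by apply: eq_bigr => j _; rewrite mxE.
Qed.

Lemma kronB p q (A B : 'M[R]_(p, q)) :
  kron (A - B) (1%:M : 'M[R]_m) = kron A 1%:M - kron B 1%:M.
Proof. by rewrite /kron -mxblockB; apply: eq_mxblock => i j;
  rewrite !mxE scalerBl. Qed.

Lemma kron1 : kron (1%:M : 'M[R]_N) (1%:M : 'M[R]_m) = 1%:M.
Proof.
suff H (x : 'cV[R]_NM) : kron (1%:M : 'M[R]_N) (1%:M : 'M[R]_m) *m x = x.
  apply/matrixP => i j; have := H (col j 1%:M).
  by rewrite {1}colE mulmxA mulmx1 -colE => /matrixP/(_ i 0); rewrite !mxE.
rewrite -[RHS]submxcolK -[LHS]submxcolK; apply: eq_mxcol => i.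
rewrite kron_block (bigD1 i)//= mxE eqxx scale1r [X in _ + X]big1 ?addr0//.
by move=> j ji; rewrite mxE eq_sym (negbTE ji) scale0r.
Qed.

(** With G the left factor above, the disagreement is (G (x) I) (L (x) I) x. *)
Lemma consensus_error_bound : exists2 c : R, 0 <= c & forall x : 'cV[R]_NM,
  enorm (x - \mxcol_(i < N) average x) <=
  c * enorm (kron (laplacian a) (1%:M : 'M[R]_m) *m x).
Proof.
have [G GL] := averaging_factor.
have [c c0 cb] := mulmx_enorm_bound (kron G (1%:M : 'M[R]_m)).
exists c => // x; apply: le_trans (cb _).
by rewrite mulmxA kron_mul -GL kronB kron1 mulmxBl mul1mx averaging_block.
Qed.

Lemma laplacian_consensus (y : 'cV[R]_m) :
  kron (laplacian a) (1%:M : 'M[R]_m) *m (\mxcol_(i < N) y) = 0.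
Proof.
rewrite -[LHS]submxcolK -[RHS]submxcolK; apply: eq_mxcol => i.
rewrite kron_block submxcol0; under eq_bigr do rewrite mxcolK.
rewrite -scaler_suml.
have := laplacian_mul (const_mx 1) i; rewrite mxE.
under eq_bigr do rewrite [X in _ * X]mxE mulr1; move=> ->.
by rewrite big1 ?scale0r// => j _; rewrite !mxE subrr mulr0.
Qed.

Lemma LKL_block (k : 'cV[R]_N) (x : 'cV[R]_NM) :
  kron (LKL a k) (1%:M : 'M[R]_m) *m x =
  kron (laplacian a) 1%:M *m (kron (diag_mx k^T) 1%:M *m
    (kron (laplacian a) 1%:M *m x)).
Proof. by rewrite /LKL !mulmxA !kron_mul. Qed.

End graph.

(** * Nash equilibria and dissipation *)

Section nash_variational.
Context {R : realType}.

Lemma derive_gradient m (f : 'cV[R]_m -> R) (x v : 'cV[R]_m) :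
  differentiable f x -> 'D_v f x = dotv (gradient f x) v.
Proof.
move=> df; rewrite deriveE//.
have vE : v = \sum_k v k 0 *: (delta_mx k 0 : 'cV[R]_m).
  apply/matrixP => i j; rewrite ord1 summxE (bigD1 i)//= big1 ?addr0.
    by rewrite !mxE !eqxx mulr1.
  by move=> k ki; rewrite !mxE eq_sym (negbTE ki) mulr0.
rewrite {1}vE linear_sum /= dotvE; apply: eq_bigr => k _.
by rewrite linearZ /= mxE deriveE// mulrC.
Qed.

(** A negative directional derivative would make f smaller than f x nearby. *)
Lemma derive_ge0_of_min m (f : 'cV[R]_m -> R) (x v : 'cV[R]_m) :
  differentiable f x ->
  (forall t : R, 0 < t -> t <= 1 -> f x <= f (x + t *: v)) -> 0 <= 'D_v f x.
Proof.
move=> df fmin; rewrite leNgt; apply/negP => D0.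
have /cvgrPdist_lt := diff_derivable (v := v) df.
move=> /(_ (- 'D_v f x)); rewrite oppr_gt0 => /(_ D0)/nbhs_ballP[d /= d0 h].
pose t := Num.min 1 (d / 2).
have t0 : 0 < t by rewrite lt_min ltr01 divr_gt0.
have td : t < d.
  by rewrite (@le_lt_trans _ _ (d / 2))// ?ge_min ?lexx ?orbT// ltr_pdivrMr//
    ltr_pMr// ltr1n.
have := h t; rewrite /ball/= sub0r normrN gtr0_norm// => /(_ td).
rewrite gt_eqF// => /(_ isT).
rewrite -/('D_v f x) ltr_norml => /andP[+ _].
have q0 : 0 <= t^-1 *: (f (t *: v + x) - f x).
  rewrite /GRing.scale/= mulr_ge0 ?invr_ge0 ?(ltW t0)// subr_ge0 addrC.
  by apply: fmin => //; rewrite ge_min lexx.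
rewrite /=; lra.
Qed.

Context {N : nat} {n : 'I_N -> nat}.
Local Notation M := (\sum_(i < N) n i)%N.
Variables (Omega : forall i, set 'cV[R]_(n i)) (J : 'I_N -> 'cV[R]_M -> R).
Arguments Omega : clear implicits.

(** Sum over the players the first-order conditions for unilateral deviations
    towards y_i. *)
Lemma Nash_variational xstar y : (forall i, segment_closed (Omega i)) ->
  (forall i, class_C1 (J i)) -> Nash_equilibrium Omega J xstar ->
  strategies Omega y -> 0 <= dotv (pseudo_gradient J xstar) (y - xstar).
Proof.
move=> sOm C1J [xO xN] yO; rewrite dotv_blocks; apply: sumr_ge0 => i _.
rewrite mxcolK submxcolB.
pose g j : 'cV[R]_(n j) :=
  dfwith (fun j => 0) i (submxcol y i - submxcol xstar i) j.
(* v is the direction in which player i alone moves towards y. *)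
pose v : 'cV[R]_M := \mxcol_j g j.
have -> : dotv (submxcol (gradient (J i) xstar) i) (submxcol y i - submxcol
  xstar i)
     = 'D_v (J i) xstar.
  rewrite derive_gradient; last exact: (C1J i).1.
  rewrite dotv_blocks [RHS](bigD1 i)//= [X in _ = _ + X]big1 ?addr0.
    by rewrite mxcolK /g dfwithin.
  by move=> j ji; rewrite mxcolK /g dfwithout 1?eq_sym// dotv0r.
apply: derive_ge0_of_min; first exact: (C1J i).1.
move=> t t0 t1; rewrite -lee_fin; apply: (le_trans (xN i)).
apply: ereal_inf_lbound.
exists (submxcol xstar i + t *: (submxcol y i - submxcol xstar i)).
  by apply: sOm => //; exact: ltW.
congr ((J i _)%:E); apply/mxcolP => j.
rewrite mxcolK submxcolD submxcolZ mxcolK /g.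
have [<-|ij] := eqVneq i j; first by rewrite !dfwithin.
by rewrite !dfwithout// scaler0 addr0.
Qed.

End nash_variational.

Section lyapunov.
Context {R : realType} {N : nat} {n : 'I_N -> nat}.
Local Notation M := (\sum_(i < N) n i)%N.
Local Notation NM := (\sum_(i < N) M)%N.
Variables (Omega : forall i, set 'cV[R]_(n i)) (J : 'I_N -> 'cV[R]_M -> R).
Arguments Omega : clear implicits.
Variables (a : 'M[R]_N) (mu lF lFF : R) (xstar : 'cV[R]_M).
Hypotheses (a_und : undirected a) (a_con : graph_connected a).
Hypotheses (mu0 : 0 < mu) (Fmono : strongly_monotone mu (pseudo_gradient J)).
Hypothesis Flip : elipschitz lF (pseudo_gradient J).
Hypotheses (lFF0 : 0 < lFF) (FFlip : elipschitz lFF (ext_pseudo_gradient J)).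
Hypothesis VI : forall y, strategies Omega y ->
  0 <= dotv (pseudo_gradient J xstar) (y - xstar).

Local Notation xbar := (\mxcol_(i < N) xstar).

Lemma ext_pseudo_gradient_consensus (y : 'cV[R]_M) :
  ext_pseudo_gradient J (\mxcol_(i < N) y) = pseudo_gradient J y.
Proof. by apply: eq_mxcol => i; rewrite mxcolK. Qed.

Lemma young_inequality (e b l : R) :
  l * e * b <= mu / 2 * b ^+ 2 + l ^+ 2 / (2 * mu) * e ^+ 2.
Proof.
have h : 0 <= (mu * b - l * e) ^+ 2 / (2 * mu).
  by rewrite divr_ge0 ?sqr_ge0// mulr_ge0// ltW.
rewrite -subr_ge0; apply: le_trans h _; rewrite le_eqVlt; apply/orP; left.
by apply/eqP; field; rewrite gt_eqF.
Qed.

Lemma gain_balance (T1 T2 T3 T4 rr q e b D : R) :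
  - (lFF * e * (e + b)) <= T1 -> - (lF * b * e) <= T2 -> mu * b ^+ 2 <= T3 ->
  0 <= T4 -> (lFF + q + mu / 2) * e ^+ 2 <= (lFF + q + mu / 2) * rr ->
  D <= mu / 2 * (e ^+ 2 + b ^+ 2) ->
  (lFF + lF) * e * b <= mu / 2 * b ^+ 2 + q * e ^+ 2 ->
  - (T1 + T2 + T3 + T4) - (lFF + q + mu / 2) * rr <= - D.
Proof. move=> *; lra. Qed.

(** Notation: u = R x, xi the average of the x^i, e the disagreement |x - 1
    (x) xi| and b = |xi - x*|.  The telescoping of <F(x), u - x*> through the
    pseudo-gradients at xi and at x* leaves mu b^2 from below, errors of order
    e b and e^2, and a nonnegative term.  Young's inequality absorbs e b in
    half of mu b^2, and e^2 is at most a multiple of |rho|^2, to be absorbed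
    by kstar. *)
Lemma gain_dominates : exists kstar c : R, 0 < c /\
  forall x : 'cV[R]_NM, strategies Omega (selmx R n *m x) ->
  - dotv (ext_pseudo_gradient J x) (selmx R n *m x - xstar) -
    kstar * dotv (kron (laplacian a) 1%:M *m x) (kron (laplacian a) 1%:M *m x)
      <=
  - c * dotv (x - xbar) (x - xbar).
Proof.
have [c c0 cb] := consensus_error_bound a_und a_con (m := M).
pose l := lFF + lF.
(* K1 e^2 covers the errors in e^2 and leaves mu / 2 (e^2 + b^2). *)
pose K1 := lFF + l ^+ 2 / (2 * mu) + mu / 2.
have K10 : 0 <= K1.
  by rewrite !addr_ge0 ?divr_ge0 ?sqr_ge0 ?mulr_ge0// ltW.
exists (c ^+ 2 * K1), (mu / (4 * (N%:R + 1))).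
have N1 : (0 : R) < N%:R + 1 by rewrite ltr_wpDl.
split; first by rewrite divr_gt0// mulr_gt0.
move=> x xO; set u := selmx R n *m x in xO *.
set r := kron _ _ *m x.
pose xi := average x; pose d := x - \mxcol_(i < N) xi.
have uxi : u - xi = selmx R n *m d by rewrite /d mulmxBr selmx_mxcol.
set e := enorm d; set b := enorm (xi - xstar).
have e0 : 0 <= e by exact: enorm_ge0.
have b0 : 0 <= b by exact: enorm_ge0.
have eu : enorm (u - xi) <= e by rewrite uxi enorm_selmx_le.
have eub : enorm (u - xstar) <= e + b.
  by apply: (le_trans (enorm_dist _ xi _)); rewrite lerD2r.
have er : e ^+ 2 <= c ^+ 2 * dotv r r.
  by rewrite -enorm_sqr -exprMn lerXn2r ?nnegrE ?mulr_ge0 ?enorm_ge0//;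
    exact: cb.
pose F0 := ext_pseudo_gradient J x; pose F1 := pseudo_gradient J xi.
pose F2 := pseudo_gradient J xstar.
have TE : dotv F0 (u - xstar) = dotv (F0 - F1) (u - xstar) +
   dotv (F1 - F2) (u - xi) + dotv (F1 - F2) (xi - xstar) + dotv F2 (u - xstar).
  exact: dotv_telescope.
have t1 : - (lFF * e * (e + b)) <= dotv (F0 - F1) (u - xstar).
  have := dotv_abs_le (F0 - F1) (u - xstar); rewrite ler_norml => /andP[h _].
  apply: le_trans h; rewrite lerN2; apply: ler_pM; rewrite ?enorm_ge0//.
  by rewrite /F1 -ext_pseudo_gradient_consensus; exact: FFlip.
have t2 : - (lF * b * e) <= dotv (F1 - F2) (u - xi).
  have := dotv_abs_le (F1 - F2) (u - xi); rewrite ler_norml => /andP[h _].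
  by apply: le_trans h; rewrite lerN2; apply: ler_pM; rewrite ?enorm_ge0//;
    exact: Flip.
have t3 : mu * b ^+ 2 <= dotv (F1 - F2) (xi - xstar).
  by rewrite dotvC; exact: Fmono.
have t4 : 0 <= dotv F2 (u - xstar) by exact: VI.
have yg := young_inequality e b l.
have dd : dotv (x - xbar) (x - xbar) <= 2 * (N%:R + 1) * (e ^+ 2 + b ^+ 2).
  have -> : x - xbar = d + \mxcol_(i < N) (xi - xstar).
    by rewrite mxcolB /d addrA subrK.
  have -> : e ^+ 2 = dotv d d by exact: enorm_sqr.
  have mc : dotv (\mxcol_(i < N) (xi - xstar)) (\mxcol_(i < N) (xi - xstar)) =
      N%:R * b ^+ 2.
    rewrite dotv_blocks; under eq_bigr do rewrite mxcolK -enorm_sqr.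
    by rewrite sumr_const card_ord mulr_natl.
  set g := \mxcol_(i < N) (xi - xstar) in mc *.
  have := dotv_ge0 (d - g); rewrite dotv_sqrB mc dotv_sqrD mc => h2.
  have : 0 <= N%:R * dotv d d by rewrite mulr_ge0// dotv_ge0.
  have : 0 <= b ^+ 2 by exact: sqr_ge0.
  move: h2; set X := dotv d d; set Y := dotv d g; set Z := b ^+ 2.
  by clearbody X Y Z; lra.
have kk : K1 * e ^+ 2 <= K1 * (c ^+ 2 * dotv r r) by rewrite ler_wpM2l.
have cc : mu / (4 * (N%:R + 1)) * dotv (x - xbar) (x - xbar) <=
   mu / (4 * (N%:R + 1)) * (2 * (N%:R + 1) * (e ^+ 2 + b ^+ 2)).
  by rewrite ler_wpM2l// divr_ge0 ?mulr_ge0 ?(ltW mu0)// ltW.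
have -> : - dotv F0 (u - xstar) - c ^+ 2 * K1 * dotv r r =
  - dotv F0 (u - xstar) - K1 * (c ^+ 2 * dotv r r) by ring.
have ccE : mu / (4 * (N%:R + 1)) * (2 * (N%:R + 1) * (e ^+ 2 + b ^+ 2)) =
   mu / 2 * (e ^+ 2 + b ^+ 2).
  by field; rewrite gt_eqF.
rewrite ccE in cc; rewrite TE mulNr.
exact: (gain_balance t1 t2 t3 t4 kk cc yg).
Qed.

End lyapunov.

(** * The closed loop as projected dynamics *)

Lemma kron_diag_block {R : realType} p m (d : 'rV[R]_p)
    (y : 'cV[R]_(\sum_(j < p) m)) i :
  submxcol (kron (diag_mx d) (1%:M : 'M[R]_m) *m y) i = d 0 i *: submxcol y i.
Proof.
rewrite kron_block (bigD1 i)//= [X in _ + X]big1; first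
  by rewrite addr0 mxE eqxx.
by move=> j ji; rewrite mxE eq_sym (negbTE ji) mulr0n scale0r.
Qed.

Section closed_loop.
Context {R : realType} {N : nat} {n : 'I_N -> nat}.
Local Notation M := (\sum_(i < N) n i)%N.
Local Notation NM := (\sum_(i < N) M)%N.
Variables (Omega : forall i, set 'cV[R]_(n i)) (J : 'I_N -> 'cV[R]_M -> R).
Arguments Omega : clear implicits.
Variables (a : 'M[R]_N) (gamma : 'I_N -> R).
Hypothesis gamma0 : forall i, 0 < gamma i.

Local Notation S := (selmx R n).
Local Notation Lx x := (kron (laplacian a) (1%:M : 'M[R]_M) *m x).
Local Notation W k := (kron (LKL a k) (1%:M : 'M[R]_M)).

(** The coordinates k_i / sqrt gamma_i turn the sum of the |k_i - kstar|^2 /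
    gamma_i into a Euclidean squared distance. *)
Definition gain_scale : 'M[R]_N := diag_mx (\row_i Num.sqrt (gamma i)).
Definition gain_unscale : 'M[R]_N := diag_mx (\row_i (Num.sqrt (gamma i))^-1).

Definition state (x : 'cV[R]_NM) (k : 'cV[R]_N) : 'cV[R]_(NM + N) :=
  col_mx x (gain_unscale *m k).
Definition gains (z : 'cV[R]_(NM + N)) : 'cV[R]_N := gain_scale *m dsubmx z.

(** The vector field before projection, extended to all the coordinates of x. *)
Definition unprojected_xdot (x : 'cV[R]_NM) (k : 'cV[R]_N) : 'cV[R]_NM :=
  - (S^T *m ext_pseudo_gradient J x) - W k *m x.

Definition field (z : 'cV[R]_(NM + N)) : 'cV[R]_(NM + N) :=
  state (unprojected_xdot (usubmx z) (gains z)) (kdot a gamma (usubmx z)).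

Definition feasible : set 'cV[R]_(NM + N) :=
  [set z | strategies Omega (S *m usubmx z)].

Let sqrtg i : Num.sqrt (gamma i) != 0.
Proof. by rewrite gt_eqF// sqrtr_gt0. Qed.

Lemma gain_scaleE (k : 'cV[R]_N) i :
  (gain_scale *m k) i 0 = Num.sqrt (gamma i) * k i 0 :> R.
Proof. by rewrite /gain_scale mul_diag_mx !mxE. Qed.

Lemma gain_unscaleE (k : 'cV[R]_N) i :
  (gain_unscale *m k) i 0 = (Num.sqrt (gamma i))^-1 * k i 0 :> R.
Proof. by rewrite /gain_unscale mul_diag_mx !mxE. Qed.

Lemma gains_state x k : gains (state x k) = k.
Proof.
apply/matrixP => i j; rewrite ord1 /gains /state col_mxKd gain_scaleE
  gain_unscaleE.
by rewrite mulrA divff ?mul1r.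
Qed.

Lemma state_gains z : state (usubmx z) (gains z) = z.
Proof.
rewrite /state /gains -[RHS]vsubmxK; congr col_mx.
apply/matrixP => i j; rewrite ord1 gain_unscaleE gain_scaleE.
by rewrite mulrA mulVf ?mul1r.
Qed.

Lemma stateB x x' k k' : state x k - state x' k' = state (x - x') (k - k').
Proof. by rewrite /state mulmxBr opp_col_mx add_col_mx. Qed.

Hypothesis a_und : undirected a.

(** L is symmetric, so LKL is the quadratic form of K at L x. *)
Lemma consensus_form x x' k : dotv (W k *m x) x' =
  \sum_i k i 0 * dotv (submxcol (Lx x) i) (submxcol (Lx x') i).
Proof.
rewrite LKL_block dotv_mulmxl kron_tr laplacian_tr// dotv_blocks.
by apply: eq_bigr => i _; rewrite kron_diag_block dotvZl mxE.
Qed.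

Lemma rho_block x i : enorm (submxcol (rho a x) i) ^+ 2 =
  dotv (submxcol (Lx x) i) (submxcol (Lx x) i).
Proof. by rewrite /rho submxcolN enormN enorm_sqr. Qed.

(** The gain part contributes the sum of the (k_i - kstar) |rho^i|^2, the
    consensus part minus the sum of the k_i |rho^i|^2. *)
Lemma field_dissipation (xstar : 'cV[R]_M) (kstar : R) z :
  let x := usubmx z in
  dotv (field z) (z - state (\mxcol_(i < N) xstar) (const_mx kstar)) =
  - dotv (ext_pseudo_gradient J x) (S *m x - xstar) - kstar *
    dotv (Lx x) (Lx x).
Proof.
move=> x; rewrite -{2}[z]state_gains stateB {1}/state dotv_col_mx.
rewrite dotvDl dotvNl dotvNl dotv_mulmxl trmxK mulmxBr selmx_mxcol.
rewrite consensus_form mulmxBr laplacian_consensus// subr0.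
rewrite -addrA; congr (_ + _).
rewrite (dotv_blocks (Lx x)) mulr_sumr -!sumrN /kdot.
rewrite dotvE -big_split/=; apply: eq_bigr => i _.
rewrite !gain_unscaleE mxE rho_block !mxE.
set q := dotv _ _; rewrite -/(gains z).
set k := gains z i 0; set s := Num.sqrt (gamma i).
have -> : gamma i = s * s by rewrite -expr2 sqr_sqrtr// ltW.
field; exact: sqrtg.
Qed.

Hypothesis sOmega : forall i, segment_closed (Omega i).
Hypothesis cOmega : forall i, closed (Omega i).
Hypothesis Omega0 : forall i, Omega i !=set0.

Lemma strategies_neq0 : strategies Omega !=set0.
Proof.
exists (\mxcol_i xget 0 (Omega i)) => i; rewrite mxcolK.
by apply: xgetPex; have [y Oy] := Omega0 i; exists y.
Qed.

Lemma strategies_segment_closed : segment_closed (strategies Omega).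
Proof.
move=> x y t t0 t1 xO yO i.
by rewrite submxcolD submxcolZ submxcolB; exact: sOmega.
Qed.

Lemma strategies_closed : closed (strategies Omega).
Proof.
apply/closed_enorm => u h i; apply: (closed_enorm (Omega i)).1 => // e e0.
have [v vO ve] := h e e0; exists (submxcol v i); first exact: vO.
by rewrite -submxcolB; apply: le_lt_trans ve; exact: enorm_block_le.
Qed.

Lemma feasible_segment_closed : segment_closed feasible.
Proof.
move=> z y t t0 t1 zO yO; rewrite /feasible /= linearD linearZ linearB /=.
rewrite mulmxDr -scalemxAr mulmxBr.
exact: strategies_segment_closed.
Qed.

Lemma feasible_closed : closed feasible.
Proof.
apply/closed_enorm => u h; apply: (closed_enorm (strategies Omega)).1.
  exact: strategies_closed.
move=> e e0; have [v vO ve] := h e e0; exists (S *m usubmx v); first exact: vO.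
rewrite -mulmxBr -linearB; apply: le_lt_trans ve.
exact: le_trans (enorm_selmx_le _) (enorm_usubmx _).
Qed.

(** R R^T = I separates the projected block from the free coordinates: the
    projection only subtracts R^T times the normal component. *)
Lemma xdotE x k : xdot Omega J a x k =
  unprojected_xdot x k - S^T *m (S *m unprojected_xdot x k -
    tproj (strategies Omega) (S *m x) (S *m unprojected_xdot x k)).
Proof.
have SfE : S *m unprojected_xdot x k =
  - ext_pseudo_gradient J x - S *m W k *m x.
  by rewrite /unprojected_xdot mulmxBr mulmxN selmx_trK mulmxA.
rewrite SfE /xdot; set p := tproj _ _ _.
rewrite /unprojected_xdot !mulmxBr mulmxN !mulmxBl mul1mx -!mulmxA.
set A := S^T *m ext_pseudo_gradient J x; set B := S^T *m p.
set D := S^T *m (S *m (W k *m x)); set E := W k *m x.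
by apply/matrixP => i j; rewrite !mxE; ring.
Qed.

(** By [xdotE] the difference between field and velocity is R^T n, with n normal
    to Omega at R x, so the inequality is that of the projection on the cone. *)
Lemma closed_loop_vi x k y : feasible y ->
  dotv (field (state x k) - state (xdot Omega J a x k) (kdot a gamma x))
       (y - state x k) <= 0.
Proof.
move=> yO; rewrite /field gains_state {2}/state col_mxKu stateB subrr.
rewrite -[y]state_gains stateB /state dotv_col_mx mulmx0 dotv0l addr0.
have SB : S *m (usubmx y - x) = S *m usubmx y - S *m x by exact: mulmxBr.
rewrite xdotE opprB addrC subrK dotv_mulmxl trmxK SB.
set v := S *m unprojected_xdot x k.
apply: tproj_vi.
- exact: strategies_neq0.
- exact: strategies_segment_closed.
- by rewrite -[_ - S *m x]scale1r; exact: tangent_cone_dir.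
Qed.

(** C is unconstrained in the directions of the gains and of the kernel of R:
    there the velocity agrees with the field, so the difference g between field
    and velocity has the form R^T n.  The remaining conditions say that R w is
    the projection of R f. *)
Lemma xdot_of_vi z w : feasible z ->
  (forall y, feasible y -> dotv (field z - w) (y - z) <= 0) ->
  dotv (field z - w) w = 0 ->
  tangent_cone (strategies Omega) (S *m usubmx z) (S *m usubmx w) ->
  usubmx w = xdot Omega J a (usubmx z) (gains z) /\
  gains w = kdot a gamma (usubmx z).
Proof.
move=> zO vi orth Tw; set x := usubmx z; set k := gains z.
set g := field z - w in vi orth *.
set g1 := usubmx g; set g2 := dsubmx g; pose w1 := usubmx w.
(* The variational inequality for the displacement (h1, h2) of z. *)
have move_ (h1 : 'cV[R]_NM) (h2 : 'cV[R]_N) :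
    strategies Omega (S *m x + S *m h1) -> dotv g1 h1 + dotv g2 h2 <= 0.
  move=> hO; have := vi (z + col_mx h1 h2); rewrite addrAC subrr add0r.
  rewrite -[g]vsubmxK dotv_col_mx; apply.
  by rewrite /feasible /= linearD /= col_mxKu mulmxDr.
have g20 : g2 = 0.
  apply: dotv_eq0; apply/eqP; rewrite eq_le dotv_ge0 andbT.
  have := move_ 0 g2; rewrite mulmx0 addr0 dotv0r add0r; exact.
have g1E : g1 = S^T *m (S *m g1).
  apply/eqP; rewrite -subr_eq0; apply/eqP/dotv_eq0/eqP.
  set h := g1 - _; have Sh : S *m h = 0 by rewrite /h mulmxBr selmx_trK subrr.
  have hh : dotv h h = dotv g1 h.
    rewrite {1}/h dotvDl dotvNl [X in _ - X]dotv_mulmxl trmxK Sh dotv0r subr0.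
    by [].
  rewrite eq_le dotv_ge0 andbT hh.
  by have := move_ h 0; rewrite Sh addr0 dotv0r addr0; exact.
have w1E : w1 = unprojected_xdot x k - g1.
  by rewrite /g1 /g linearB /= /field /state col_mxKu subKr.
have pE : tproj (strategies Omega) (S *m x) (S *m unprojected_xdot x k) =
  S *m w1.
  have vp : S *m unprojected_xdot x k - S *m w1 = S *m g1.
    by rewrite -mulmxBr w1E subKr.
  apply: tproj_unique => //.
  - rewrite vp dotvC dotv_mulmxl -g1E dotvC.
    by have := orth; rewrite -[g]vsubmxK -[w in dotv _ w]vsubmxK dotv_col_mx
      -/g2 g20 dotv0l addr0.
  - move=> y yO; rewrite vp -[y - _]selmx_trK dotvC dotv_mulmxl -g1E dotvC.
    have := move_ (S^T *m (y - S *m x)) 0;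
      rewrite selmx_trK addrC subrK dotv0r addr0.
    by apply.
split.
  rewrite xdotE pE -/x -/k -/w1.
  have -> : S *m unprojected_xdot x k - S *m w1 = S *m g1.
    by rewrite -mulmxBr w1E subKr.
  by rewrite -g1E w1E.
have : dsubmx w = dsubmx (field z).
  by apply/esym/eqP; rewrite -subr_eq0 -linearB /= -/g -/g2 g20.
rewrite /gains => ->.
by have := gains_state (unprojected_xdot x k) (kdot a gamma x); rewrite /gains.
Qed.

End closed_loop.

Section field_regularity.
Context {R : realType} {N : nat} {n : 'I_N -> nat}.
Local Notation M := (\sum_(i < N) n i)%N.
Local Notation NM := (\sum_(i < N) M)%N.
Variables (J : 'I_N -> 'cV[R]_M -> R) (a : 'M[R]_N) (gamma : 'I_N -> R).
Variable lFF : R.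
Hypotheses (lFF0 : 0 < lFF) (FFlip : elipschitz lFF (ext_pseudo_gradient J)).

(** Coordinatewise, the field is a polynomial in z plus the pseudo-gradient
    term, which is Lipschitz by assumption. *)
Lemma field_loc_lip (zbar : 'cV[R]_(NM + N)) (r : R) :
  exists2 L : R, 0 <= L & forall x y,
    enorm (x - zbar) <= r -> enorm (y - zbar) <= r ->
    enorm (field J a gamma x - field J a gamma y) <= L * enorm (x - y).
Proof.
pose P : set 'cV[R]_(NM + N) := [set z | enorm (z - zbar) <= r].
have [r0|r0] := ltP r 0.
  exists 0 => // x y xr _; have := le_lt_trans (le_trans (enorm_ge0 _) xr) r0.
  by rewrite ltxx.
pose rad := r + enorm zbar.
have rad0 : 0 <= rad by rewrite addr_ge0// enorm_ge0.
have Pb z : P z -> enorm z <= rad.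
  move=> Pz; have := enorm_dist z zbar 0; rewrite !subr0 => /le_trans; apply.
  by rewrite lerD2r.
have P0 : P !=set0 by exists zbar; rewrite /P /= subrr enorm0.
have ext h g : h =1 g -> bounded_lip P g -> bounded_lip P h.
  by move=> /funext ->.
have coord i : bounded_lip P (fun z => z i 0)
  by exact: bounded_lip_coord Pb rad0 i.
have xcoord i : bounded_lip P (fun z => usubmx z i 0).
  by apply: ext (coord (lshift N i)) => z; rewrite mxE.
have cst c : bounded_lip P (fun=> c) by exact: bounded_lip_cst.
have Lx_lip (i : 'I_N) k : bounded_lip P (fun z =>
    submxcol (kron (laplacian a) (1%:M : 'M[R]_M) *m usubmx z) i k 0).
  apply: (ext _ (fun z => \sum_s kron (laplacian a) (1%:M : 'M[R]_M)
    (tagnat.Rank i k) s * usubmx z s 0)); first by move=> z; rewrite mxE mxE.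
  by apply: bounded_lip_sum => s; exact: bounded_lip_mul.
have k_lip i : bounded_lip P (fun z => gains gamma z i 0).
  apply: (ext _ (fun z => Num.sqrt (gamma i) * z (rshift NM i) 0)).
    by move=> z; rewrite /gains gain_scaleE mxE.
  exact: bounded_lip_mul.
have W_lip i j : bounded_lip P (fun z => LKL a (gains gamma z) i j).
  apply: (ext _ (fun z => \sum_l (\sum_l' laplacian a i l' *
     (gains gamma z l' 0 * (l' == l)%:R)) * laplacian a l j)).
    move=> z; rewrite /LKL mxE; apply: eq_bigr => l _; congr (_ * _).
    rewrite mxE; apply: eq_bigr => l' _; congr (_ * _).
    by rewrite !mxE mulr_natr.
  apply: bounded_lip_sum => l; apply: bounded_lip_mul => //.
  apply: bounded_lip_sum => l'; apply: bounded_lip_mul => //.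
  exact: bounded_lip_mul.
apply: (bounded_lip_vector (P := P)) => i; case: (split_ordP i) => j ->.
- apply: (ext _ (fun z => (- ((selmx R n)^T *m ext_pseudo_gradient J (usubmx
  z))) j 0 +
    (-1) * \sum_s (LKL a (gains gamma z) (tagnat.sig1 j) (tagnat.sig1 s) *
       (1%:M : 'M[R]_M) (tagnat.sig2 j) (tagnat.sig2 s)) * usubmx z s 0)).
    move=> z; rewrite /field /state col_mxEu /unprojected_xdot mxE;
      congr (_ + _).
    rewrite mulN1r mxE; congr (- _); rewrite mxE; apply: eq_bigr => s _.
    by rewrite /kron mxE mxE.
  apply: bounded_lip_add; last first.
    apply: bounded_lip_mul => //; apply: bounded_lip_sum => s.
    by apply: bounded_lip_mul => //; exact: bounded_lip_mul.
  have [c c0 cb] := mulmx_enorm_bound (selmx R n)^T.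
  apply: (bounded_lip_of_lip Pb rad0 (L := c * lFF)) => //.
    by rewrite mulr_ge0// ltW.
  move=> z y; set A := (selmx R n)^T.
  have negB (u v : 'cV[R]_NM) : (- u) j 0 - (- v) j 0 = (v - u) j 0.
    by rewrite !mxE; ring.
  rewrite negB -mulmxBr; apply: (le_trans (coord_le_enorm _ _)).
  apply: (le_trans (cb _)); rewrite -mulrA ler_wpM2l//.
  apply: (le_trans (FFlip _ _)); rewrite ler_wpM2l ?(ltW lFF0)//.
  by rewrite -linearB (enormB z) enorm_usubmx.
- apply: (ext _ (fun z => (Num.sqrt (gamma j))^-1 * (gamma j * \sum_k
    (submxcol (kron (laplacian a) (1%:M : 'M[R]_M) *m usubmx z) j k 0 *
     submxcol (kron (laplacian a) (1%:M : 'M[R]_M) *m usubmx z) j k 0)))).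
    move=> z; rewrite /field /state col_mxEd gain_unscaleE mxE rho_block.
    by rewrite dotvE.
  do 2 apply: bounded_lip_mul => //.
  by apply: bounded_lip_sum => k; exact: bounded_lip_mul.
Qed.

End field_regularity.

(** * Convergence of the adaptive-gain dynamics *)

Theorem theorem3 (R : realType) (N : nat) (n : 'I_N -> nat)
    (Omega : forall i : 'I_N, set 'cV[R]_(n i))
    (J : 'I_N -> 'cV[R]_(\sum_(i < N) n i) -> R)
    (a : 'M[R]_N) (mu lF lFF : R) (gamma : 'I_N -> R)
    (xstar : 'cV[R]_(\sum_(i < N) n i)) :
  (forall i, Omega i !=set0) ->
  (forall i, convex_set (Omega i)) ->
  (forall i, compact (Omega i)) ->
  (forall i, class_C1 (J i)) ->
  (forall i, cost_convex Omega J i) ->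
  undirected a -> graph_connected a ->
  0 < mu -> strongly_monotone mu (pseudo_gradient J) ->
  0 < lF -> elipschitz lF (pseudo_gradient J) ->
  0 < lFF -> elipschitz lFF (ext_pseudo_gradient J) ->
  (forall i, 0 < gamma i) ->
  Nash_equilibrium Omega J xstar ->
  forall (x0 : 'cV[R]_(\sum_(i < N) \sum_(j < N) n j)) (k0 : 'cV[R]_N),
  Xi Omega (x0, k0) ->
  exists (x : R -> 'cV[R]_(\sum_(i < N) \sum_(j < N) n j)) (k : R -> 'cV[R]_N),
    (x 0 = x0 /\ k 0 = k0) /\
    Caratheodory_solution Omega J a gamma x k /\
    (forall (x' : R -> 'cV[R]_(\sum_(i < N) \sum_(j < N) n j))
            (k' : R -> 'cV[R]_N),
       x' 0 = x0 -> k' 0 = k0 ->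
       Caratheodory_solution Omega J a gamma x' k' ->
       forall t : R, 0 <= t -> x' t = x t /\ k' t = k t) /\
    (forall t : R, 0 <= t -> Xi Omega (x t, k t)) /\
    x t @[t --> +oo] --> \mxcol_(i < N) xstar.
Proof.
move=> Omega0 Omega_cvx Omega_cpt JC1 _ a_und a_con mu0 Fmono lF0 Flip lFF0
  FFlip.
move=> gamma0 xNash x0 k0 x0O.
have sOmega i : segment_closed (Omega i) by exact: convex_segment_closed.
have cOmega i : closed (Omega i).
  by apply: compact_closed => //; exact: norm_hausdorff.
have VI y : strategies Omega y ->
  0 <= dotv (pseudo_gradient J xstar) (y - xstar).
  exact: Nash_variational.
have [kstar [c [c0 gain]]] := gain_dominates a_und a_con mu0 Fmono Flip lFF0
  FFlip VI.
pose xbar := \mxcol_(i < N) xstar.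
pose C := @feasible R N n Omega; pose f := field J a gamma.
pose zbar := state gamma xbar (const_mx kstar); pose z0 := state gamma x0 k0.
pose diss (z : 'cV[R]_(\sum_(i < N) \sum_(i < N) n i + N)) :=
  c * dotv (usubmx z - xbar) (usubmx z - xbar).
have Cclosed : closed C by exact: feasible_closed.
have Ccvx : segment_closed C by exact: feasible_segment_closed.
have Czbar : C zbar.
  by rewrite /C /feasible /= col_mxKu selmx_mxcol; case: xNash.
have Cz0 : C z0 by rewrite /C /feasible /= col_mxKu.
have flip := field_loc_lip a gamma lFF0 FFlip zbar.
have diss0 z : C z -> 0 <= diss z.
  by move=> _; rewrite mulr_ge0 ?(ltW c0)// dotv_ge0.
have fdiss z : C z -> dotv (f z) (z - zbar) <= - diss z.
  by move=> Cz; rewrite field_dissipation// /diss -[leRHS]mulNr; exact: gain.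
have [z [zz0 zC [K zlip] zsol [zb zconv]]] :=
  projected_dynamics_solution Cclosed Ccvx Czbar Cz0 flip diss0 fdiss.
pose x t := usubmx (z t); pose k t := gains gamma (z t).
have dux (y : R -> 'cV[R]_(\sum_(i < N) \sum_(i < N) n i + N)) (t : R) w :
    is_derive t (1 : R) y w ->
    is_derive t (1 : R) (fun s => usubmx (y s)) (usubmx w).
  apply: (@is_derive_linear _ _ _ usubmx 1) => // v.
  by rewrite mul1r enorm_usubmx.
have dgains (y : R -> 'cV[R]_(\sum_(i < N) \sum_(i < N) n i + N)) (t : R) w :
    is_derive t (1 : R) y w ->
    is_derive t (1 : R) (fun s => gains gamma (y s)) (gains gamma w).
  move=> dy; apply: is_derive_mulmx.
  apply: (@is_derive_linear _ _ _ dsubmx 1) => // v.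
  by rewrite mul1r enorm_dsubmx.
exists x, k; split.
  by rewrite /x /k zz0 gains_state// col_mxKu.
split.
- split=> [T1 T2 T10 T12|].
    have [b b0 bb] := mulmx_enorm_bound (gain_scale gamma).
    split.
      apply: (@lipschitz_abs_continuous _ _ _ K _ _ T10) => s t s0 t0.
      apply: le_trans (zlip s t s0 t0).
      by rewrite /x -linearB enorm_usubmx.
    apply: (@lipschitz_abs_continuous _ _ _ (b * K) _ _ T10) => s t s0 t0.
    rewrite /k /gains -mulmxBr -linearB; apply: (le_trans (bb _)).
    rewrite -mulrA ler_wpM2l//; apply: le_trans (zlip s t s0 t0).
    exact: enorm_dsubmx.
  apply: (@filterS _ _ (ae_filter_ringOfSetsType (@lebesgue_measure R)) _ _ _
    zsol).
  move=> t zt t0; have [w [tp [dw vi] orth]] := zt t0.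
  have [wx wk] : usubmx w = xdot Omega J a (usubmx (z t)) (gains gamma (z t)) /\
      gains gamma w = kdot a gamma (usubmx (z t)).
    apply: xdot_of_vi => //; first exact: zC.
    apply: (@curve_tangent _ _ (fun s => selmx R n *m usubmx (z s))) => //.
    by apply: is_derive_mulmx; exact: dux.
  by split; [rewrite -wx; exact: dux|rewrite -wk; exact: dgains].
split.
- move=> x' k' x'0 k'0 [ac' sol'] T T0.
  pose z2 t := state gamma (x' t) (k' t).
  have z2ac T' : 0 <= T' -> abs_continuous 0 T' z2.
    move=> T'0; have [acx ack] := ac' 0 T' (lexx _) T'0.
    have [b b0 bb] := mulmx_enorm_bound (gain_unscale gamma).
    have /abs_continuousP acx' := acx; have /abs_continuousP ack' := ack.
    apply/abs_continuousP.
    apply: (ac_increments_control (A := 1 + b) (B := 0)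
      _ _ (ac_increments_add acx' ack')) => //.
      by rewrite addr_ge0.
    move=> s t _ _ _; split; first by rewrite addr_ge0// enorm_ge0.
    rewrite mul0r addr0 stateB; apply: (le_trans (enorm_col_mx _ _)).
    have := bb (k' t - k' s).
    have := mulr_ge0 b0 (enorm_ge0 (x' t - x' s)).
    have := enorm_ge0 (k' t - k' s); lra.
  have z2C t : 0 <= t -> C (z2 t).
    move=> t0; rewrite /C /feasible /= col_mxKu.
    apply: (@ae_viable _ _ (fun s => selmx R n *m x' s) _ t t0).
    - exact: strategies_neq0.
    - exact: strategies_closed.
    - exact: strategies_segment_closed.
    - have [/abs_continuousP acx _] := ac' 0 t (lexx _) t0.
      apply/abs_continuousP.
      apply: (ac_increments_control (A := 1) (B := 0) _ _ acx) => // s s' _ _ _.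
      split; first exact: enorm_ge0.
      by rewrite mul0r addr0 mul1r -mulmxBr enorm_selmx_le.
    - by rewrite x'0.
    - apply: (@filterS _ _ (ae_filter_ringOfSetsType (@lebesgue_measure R)) _ _
      _ sol').
      move=> s ds s0 st; have [dx _] := ds s0.
      exists (selmx R n *m xdot Omega J a (x' s) (k' s)); split.
        exact: is_derive_mulmx.
      rewrite xdotE mulmxBr selmx_trK subKr; apply: tproj_tangent.
      exact: strategies_neq0.
  have zz2 : z T = z2 T.
    apply: (projected_dynamics_unique Czbar flip diss0 fdiss T0 _ zC z2C zb _
      zlip z2ac) => //.
    - by rewrite /z2 x'0 k'0.
    - by rewrite /z2 x'0 k'0.
    - apply: (@filterS _ _ (ae_filter_ringOfSetsType (@lebesgue_measure R)) _ _
      _ zsol).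
      by move=> t zt t0; have [w [_ sw _]] := zt t0; exists w.
    - apply: (@filterS _ _ (ae_filter_ringOfSetsType (@lebesgue_measure R)) _ _
      _ sol').
      move=> t dt t0; have [dx dk] := dt t0.
      exists (state gamma (xdot Omega J a (x' t) (k' t)) (kdot a gamma (x' t))).
      split; first by apply: is_derive_col_mx => //; exact: is_derive_mulmx.
      by move=> y yC; exact: closed_loop_vi.
  by rewrite /x /k zz2 gains_state// col_mxKu.
split; first by move=> t t0; exact: zC.
apply/cvg_enorm => e e0.
have ce0 : 0 < c * e ^+ 2 by rewrite mulr_gt0// exprn_gt0.
have [T [T0 zT]] := zconv _ ce0.
exists T; split; first exact: num_real.
move=> t Tt; have := zT t (ltW Tt); rewrite /diss ltr_pM2l// -enorm_sqr.
by rewrite ltr_pXn2r ?nnegrE ?enorm_ge0// ltW.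
Qed.
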